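(* Let $G$ be a totally disconnected locally compact group, $R$ a commutative ring with the discrete topology, and $n\in\mathbb{N}\cup\{\infty\}$. A discrete $R[G]$-module $M$ has type $\mathrm{FP}_n$ over $R$ if and only if it has type $\mathrm{KP}_n$ over $R$.
   Context: An abstract left $R[G]$-module $M$ is discrete if the stabiliser of every $m\in M$ is open in $G$. A proper discrete permutation $R[G]$-module is a module $R[\Omega]$ freely $R$-spanned by a left $G$-set $\Omega$ all of whose point stabilisers are compact open. A discrete $R[G]$-module $M$ has type $\mathrm{FP}_n$ over $R$ ($n\in\mathbb{N}\cup\{\infty\}$) if it has a resolution $\cdots\to P_1\to P_0\to M\to0$ by proper discrete permutation $R[G]$-modules (not required to be projective) with $P_i$ finitely generated for all $i\le n$. A $k$-space is a compactly generated weakly Hausdorff space; products are taken in the category of $k$-spaces. The group ring $R[G]$ carries a topology making it a $k$-$R$-algebra such that every continuous homomorphism from $G$ to the unit group of a $k$-$R$-algebra $S$ factors uniquely through $R[G]\to S$. A $k$-$R[G]$-module is a module object over $R[G]$ in $k$-spaces (a $k$-space that is an $R$-module with continuous operations and a continuous $R$-linear action of $G$); morphisms are continuous module homomorphisms. Discrete $R[G]$-modules, with the discrete topology, are $k$-$R[G]$-modules. For a $k$-space $Y$, the free $k$-$R[G]$-module $R[G\times Y]$ on $Y$ is the value at $Y$ of the left adjoint of the forgetful functor to $k$-spaces. The projective objects considered are the direct summands of free $k$-$R[G]$-modules on disjoint unions of compact Hausdorff spaces; a morphism $A\to B$ is CH-split if every morphism from a projective object to $B$ lifts to $A$. A projective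 resolution of $A$ is an exact chain complex $\cdots\to P_1\xrightarrow{d_1}P_0\xrightarrow{d_0}A\to0$ with all $P_i$ projective such that each map $P_i\to\ker(d_{i-1})$ is CH-split (for $i=0$: $P_0\to A$ is CH-split). A $k$-$R[G]$-module is compactly generated if there is a CH-split map onto it from a free module on a compact Hausdorff space. $A$ has type $\mathrm{KP}_n$ over $R$ if it has a projective resolution $P\to A$ with $P_i$ compactly generated for all $i\le n$. *)

(* Defs.v *)
From HB Require Import structures.
From mathcomp Require Import all_boot all_order all_algebra.
From mathcomp Require Import all_classical all_reals topology.

Set Implicit Arguments.
Unset Strict Implicit.
Unset Printing Implicit Defensive.

Import GRing.Theory.

Local Open Scope classical_set_scope.
Local Open Scope ring_scope.

Definition compact_hausdorff (K : topologicalType) : Prop :=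
  compact [set: K] /\ hausdorff_space K.

Definition compactly_generated_space (X : topologicalType) : Prop :=
  forall A : set X,
    (forall (K : topologicalType) (u : K -> X),
       compact_hausdorff K -> continuous u -> closed (u @^-1` A)) ->
    closed A.

Definition weakly_hausdorff (X : topologicalType) : Prop :=
  forall (K : topologicalType) (u : K -> X),
    compact_hausdorff K -> continuous u -> closed (range u).

Definition k_space (X : topologicalType) : Prop :=
  compactly_generated_space X /\ weakly_hausdorff X.

(* [kify X] is the type [X] with the finest topology for which the continuous
   maps from compact Hausdorff spaces to [X] are still continuous.  For k-spaces
   [X] and [Y], [kify (X * Y)] is their product in the category of k-spaces. *)
Definition kify (X : topologicalType) : Type := X.

HB.instance Definition _ (X : topologicalType) := Choice.copy (kify X) X.

Definition kify_open (X : topologicalType) (U : set (kify X)) : Prop :=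
  forall (K : topologicalType) (u : K -> X),
    compact_hausdorff K -> continuous u -> open (u @^-1` U).

Lemma kify_openT (X : topologicalType) : kify_open [set: kify X].
Proof. by move=> K u _ _; rewrite preimage_setT; exact: openT. Qed.

Lemma kify_openI (X : topologicalType) : setI_closed (@kify_open X).
Proof.
by move=> U V oU oV K u cK cu; rewrite preimage_setI; apply: openI; auto.
Qed.

Lemma kify_open_bigU (X : topologicalType) (I : Type) (f : I -> set (kify X)) :
  (forall i, kify_open (f i)) -> kify_open (\bigcup_i f i).
Proof.
move=> of_ K u cK cu; rewrite preimage_bigcup; apply: bigcup_open => i _.
exact: of_.
Qed.

HB.instance Definition _ (X : topologicalType) :=
  isOpenTopological.Build (kify X)
    (@kify_openT X) (@kify_openI X) (@kify_open_bigU X).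

Lemma kify_openE (X : topologicalType) :
  @open (kify X) = @kify_open X.
Proof. by []. Qed.

Lemma kify_continuousP (X Y : topologicalType) (f : kify X -> Y) :
  (forall (K : topologicalType) (u : K -> X),
     compact_hausdorff K -> continuous u -> continuous (f \o u)) <->
  continuous f.
Proof.
split=> [fK|/continuousP fc K u cK cu].
  apply/continuousP => U oU; rewrite kify_openE => K u cK cu.
  by rewrite -comp_preimage; have /continuousP := fK K u cK cu; apply.
apply/continuousP => U oU; rewrite comp_preimage.
by have := fc U oU; rewrite kify_openE; apply.
Qed.

Lemma discrete_k_space (T : choiceType) : k_space (discrete_topology T).
Proof. by split=> [A _|K u _ _]; exact: discrete_closed. Qed.

HB.mixin Record Topological_isTopologicalGroup G of Topological G & Group G := {
  mulg_continuous : continuous (fun x : G * G => (x.1 * x.2)%g);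
  invg_continuous : continuous (fun x : G => (x^-1)%g)
}.

#[short(type="topGroupType")]
HB.structure Definition TopologicalGroup :=
  {G of Topological G & Group G & Topological_isTopologicalGroup G}.

Definition tdlc (G : topGroupType) : Prop :=
  [/\ hausdorff_space G, locally_compact [set: G] &
      totally_disconnected [set: G]].

HB.mixin Record Lmodule_isRGModule (R : comPzRingType) (G : groupType) M
    of GRing.Lmodule R M := {
  gact : G -> M -> M;
  gact1 : forall x, gact 1%g x = x;
  gactM : forall g h x, gact (g * h)%g x = gact g (gact h x);
  gact_linear : forall g, linear (gact g)
}.

#[short(type="rgModType")]
HB.structure Definition RGModule (R : comPzRingType) (G : groupType) :=
  {M of GRing.Lmodule R M & Lmodule_isRGModule R G M}.

HB.mixin Record RGModule_isDiscrete (R : comPzRingType) (G : topGroupType) M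
    of RGModule R G M := {
  open_stabiliser : forall m : M, open [set g : G | gact g m = m]
}.

#[short(type="discreteRGModType")]
HB.structure Definition DiscreteRGModule (R : comPzRingType)
    (G : topGroupType) :=
  {M of RGModule R G M & RGModule_isDiscrete R G M}.

(* [R] carries the discrete topology. *)
HB.mixin Record RGModule_isKRGModule (R : comPzRingType) (G : topGroupType) M
    of Topological M & RGModule R G M := {
  krg_k_space : k_space M;
  krg_add_continuous :
    continuous (fun z : kify (M * M)%type => z.1 + z.2 : M);
  krg_scale_continuous :
    continuous (fun z : kify (discrete_topology R * M)%type =>
                  (z.1 : R) *: (z.2 : M));
  krg_act_continuous :
    continuous (fun z : kify (G * M)%type => gact z.1 z.2 : M)
}.

#[short(type="kRGModType")]
HB.structure Definition KRGModule (R : comPzRingType) (G : topGroupType) :=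
  {M of Topological M & RGModule R G M & RGModule_isKRGModule R G M}.

Section discrete_kRGModule.
Context (R : comPzRingType) (G : topGroupType).

(* Discrete [R[G]]-modules, with the discrete topology, are k-[R[G]]-modules. *)
HB.instance Definition _ (M : lmodType R) :=
  GRing.Lmodule.copy (discrete_topology M) M.
HB.instance Definition _ (M : rgModType R G) :=
  RGModule.copy (discrete_topology M) M.

Lemma continuous_kify (X Y : topologicalType) (f : X -> Y) :
  continuous f -> continuous (f : kify X -> Y).
Proof.
move=> cf; apply/kify_continuousP => K u _ cu x.
exact: continuous_comp (cu x) (cf _).
Qed.

Variable M : discreteRGModType R G.
Local Notation dM := (discrete_topology M).

Lemma discrete_add_continuous :
  continuous (fun z : kify (dM * dM)%type => z.1 + z.2 : dM).
Proof.
apply: (@continuous_kify (dM * dM)%type) => -[x y] U /nbhs_singleton /= Uxy.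
exists ([set x], [set y]); first by split; exact: discrete_set1.
by move=> [a b] [/= -> ->].
Qed.

Lemma discrete_scale_continuous :
  continuous (fun z : kify (discrete_topology R * dM)%type =>
    (z.1 : R) *: (z.2 : dM)).
Proof.
apply: (@continuous_kify (discrete_topology R * dM)%type).
move=> -[x y] U /nbhs_singleton /= Uxy.
exists ([set x], [set y]); first by split; exact: discrete_set1.
by move=> [a b] [/= -> ->].
Qed.

Lemma discrete_act_continuous :
  continuous (fun z : kify (G * dM)%type => gact z.1 z.2 : dM).
Proof.
apply: (@continuous_kify (G * dM)%type) => -[g m] U /nbhs_singleton /= Ugm.
exists ([set h | gact (g^-1 * h)%g m = m], [set m]); last first.
  move=> [h b] [/= hm ->]; suff -> : gact h m = gact g m by [].
  by rewrite -[in RHS]hm -gactM mulgA mulgV mul1g.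
split; last exact: discrete_set1.
apply: open_nbhs_nbhs; split; last by rewrite /= mulVg gact1.
have := @open_stabiliser R G M m.
apply: (@open_comp _ _ (fun h : G => (g^-1 * h)%g)) => h _.
apply: (@continuous_comp _ _ _ (fun h : G => (g^-1%g, h))
          (fun x : G * G => (x.1 * x.2)%g)); last exact: mulg_continuous.
by apply: cvg_pair => //=; exact: cvg_cst.
Qed.

HB.instance Definition _ := RGModule_isKRGModule.Build R G dM
  (@discrete_k_space M) discrete_add_continuous discrete_scale_continuous
  discrete_act_continuous.

End discrete_kRGModule.

Section morphisms.
Context (R : comPzRingType) (G : groupType).

Definition rg_morphism (A B : rgModType R G) (f : A -> B) : Prop :=
  linear f /\ forall g x, f (gact g x) = gact g (f x).

End morphisms.

Record khom (R : comPzRingType) (G : topGroupType) (A B : kRGModType R G) := KHom {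
  khom_fun :> A -> B;
  khom_morphism : rg_morphism khom_fun;
  khom_continuous : continuous khom_fun
}.

Lemma continuous_closed_preimage (X Y : topologicalType) (f : X -> Y)
    (C : set Y) :
  continuous f -> closed C -> closed (f @^-1` C).
Proof. by move=> cf; apply: preimage_closed => x _; exact: cf. Qed.

Lemma continuous_comp_all (X Y Z : topologicalType) (f : X -> Y) (g : Y -> Z) :
  continuous f -> continuous g -> continuous (fun x => g (f x)).
Proof. by move=> cf cg x; apply: continuous_comp; [exact: cf|exact: cg]. Qed.

Lemma closed_set1_k (X : topologicalType) (x : X) :
  k_space X -> closed [set x].
Proof.
move=> [_ wX].
have -> : [set x] = range (fun _ : discrete_topology unit => x).
  by apply/seteqP; split=> [y -> /=|y [_ _ <-] //]; exists tt.
apply: wX; last by move=> ?; exact: cvg_cst.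
split; last by move=> [] [].
have -> : [set: discrete_topology unit] = [set tt].
  by apply/seteqP; split=> [[]|].
exact: compact_set1.
Qed.

Section set_type.
Context (X : topologicalType) (A : set X).

Lemma set_val_continuous : continuous (set_val : A -> X).
Proof. exact: initial_continuous. Qed.

Lemma set_type_continuous (Z : topologicalType) (h : Z -> A) :
  continuous (set_val \o h) -> continuous h.
Proof.
move=> /continuousP ch; apply/continuousP => U [V oV <-].
exact: ch oV.
Qed.

Lemma set_type_compact_hausdorff :
  compact_hausdorff X -> closed A -> compact_hausdorff A.
Proof.
move=> [cX hX] cA; split.
  move=> F FF _.
  have cpA : compact A := subclosed_compact cA cX (@subsetT _ _).
  have FA : (set_val @ F) A.
    by apply: (@filterE _ F) => a; have /set_mem := valP a.
  have [p [Ap clp]] := cpA (set_val @ F) _ FA.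
  exists (exist _ p (mem_set Ap)); split=> // U V FU.
  rewrite nbhsE => -[_ [[W oW <-] /= Wp] sWV].
  have FU' : (set_val @ F) (set_val @` U).
    by apply: (@filterS _ F _ U) => // a Ua; exists a.
  have [x [[y Uy yx] Wx]] := clp _ W FU' (open_nbhs_nbhs (conj oW Wp)).
  by exists y; split=> //; apply: sWV; rewrite /= yx.
move=> p q cpq; apply: val_inj; apply: hX => U V Up Vq.
have [x [Ux Vx]] := cpq _ _ (set_val_continuous Up) (set_val_continuous Vq).
by exists (set_val x).
Qed.

End set_type.

Lemma set_type_k_space (X : topologicalType) (A : set X) :
  k_space X -> closed A -> k_space A.
Proof.
move=> [gX wX] cA; split.
  move=> C testC.
  have cC : closed (set_val @` C).
    apply: gX => K u cK cu.
    have cL : closed (u @^-1` A) by apply: continuous_closed_preimage.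
    have uL (y : (u @^-1` A : set K)) : u (set_val y) \in A.
      by apply/mem_set; have /set_mem := valP y.
    pose v (y : (u @^-1` A : set K)) : A := exist _ (u (set_val y)) (uL y).
    have cv : continuous v.
      apply: set_type_continuous.
      exact: continuous_comp_all (@set_val_continuous _ _) cu.
    have := testC _ v (set_type_compact_hausdorff cK cL) cv.
    rewrite -openC => -[W oW WE].
    suff -> : u @^-1` (set_val @` C) = u @^-1` A `&` ~` W.
      by apply: closedI => //; exact: open_closedC.
    apply/seteqP; split=> [y [[a Aa] Ca /= ay]|y [Ay nWy]].
      have Ay : A (u y) by rewrite -ay; exact: set_mem.
      split=> // Wy.
      have : (set_val @^-1` W) (exist _ y (mem_set (Ay : (u @^-1` A) y))) by [].
      rewrite WE; apply; rewrite /preimage /=.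
      by congr C: Ca; exact: val_inj.
    pose y' : (u @^-1` A : set K) := exist _ y (mem_set (Ay : (u @^-1` A) y)).
    exists (v y') => //; apply: contrapT => nC.
    by apply: nWy; have : (~` (v @^-1` C)) y' by []; rewrite -WE.
  have -> : C = set_val @^-1` (set_val @` C).
    by apply/seteqP; split=> [a Ca|a [b Cb /val_inj <-]]; [exists a|].
  by apply: continuous_closed_preimage cC; exact: set_val_continuous.
move=> K u cK cu.
have -> : range u = set_val @^-1` range (set_val \o u).
  apply/seteqP; split=> [_ [y _ <-]|a [y _ /val_inj <-]]; first by exists y.
  by exists y.
apply: continuous_closed_preimage; first exact: set_val_continuous.
by apply: wX cK _; exact: continuous_comp_all cu (@set_val_continuous _ _).
Qed.

(* [kernel f] has the subspace topology from [A]. *)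
Section kernel.
Context (R : comPzRingType) (G : topGroupType) (A B : kRGModType R G).
Variable f : khom A B.

Definition kernel : Type := [set x : A | f x = 0].

HB.instance Definition _ := Topological.on kernel.
HB.instance Definition _ := SubChoice.on kernel.

Lemma kernel_subsemimod_closed :
  subsemimod_closed (fun x => x \in [set x : A | f x = 0]).
Proof.
have [fL _] := khom_morphism f.
have f0 : f 0 = 0 by have := fL (-1) 0 0; rewrite !scaleN1r !addNr.
split; first split.
- exact/mem_set.
- move=> x y /set_mem /= fx /set_mem /= fy; apply/mem_set => /=.
  by have := fL 1 x y; rewrite !scale1r fx fy addr0.
- move=> a x /set_mem /= fx; apply/mem_set => /=.
  by have := fL a x 0; rewrite fx f0 scaler0 !addr0.
Qed.

HB.instance Definition _ := GRing.SubChoice_isSubLmodule.Build R A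
  (fun x => x \in [set x : A | f x = 0]) kernel kernel_subsemimod_closed.

Lemma kernel_gact_subproof (g : G) (x : kernel) :
  gact g (val x) \in [set x : A | f x = 0].
Proof.
have [fL fG] := khom_morphism f.
have f0 : f 0 = 0 by have := fL (-1) 0 0; rewrite !scaleN1r !addNr.
have g0 : gact g (0 : B) = 0.
  by have := @gact_linear R G B g (-1) 0 0; rewrite !scaleN1r !addNr.
by apply/mem_set; rewrite /= fG; case: x => x /= /set_mem ->.
Qed.

Definition kernel_gact (g : G) (x : kernel) : kernel :=
  Sub (gact g (val x)) (kernel_gact_subproof g x).

Lemma kernel_gact1 x : kernel_gact 1%g x = x.
Proof. by apply: val_inj; rewrite SubK gact1. Qed.

Lemma kernel_gactM g h x :
  kernel_gact (g * h)%g x = kernel_gact g (kernel_gact h x).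
Proof. by apply: val_inj; rewrite !SubK gactM. Qed.

Lemma kernel_gact_linear g : linear (kernel_gact g).
Proof.
move=> a x y; apply: val_inj.
by rewrite SubK !linearP /= gact_linear.
Qed.

HB.instance Definition _ := Lmodule_isRGModule.Build R G kernel
  kernel_gact1 kernel_gactM kernel_gact_linear.

Lemma kernel_k_space : k_space kernel.
Proof.
apply: set_type_k_space; first exact: krg_k_space.
have -> : [set x : A | f x = 0] = f @^-1` [set 0] by [].
apply: continuous_closed_preimage; first exact: khom_continuous.
exact: closed_set1_k krg_k_space.
Qed.

Lemma kernel_op_continuous (S' S : topologicalType) (s : S' -> S)
    (op : S -> A -> A) (op' : S' -> kernel -> kernel) :
  continuous s -> (forall t x, val (op' t x) = op (s t) (val x)) ->
  continuous (fun z : kify (S * A)%type => op z.1 z.2) ->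
  continuous (fun z : kify (S' * kernel)%type => op' z.1 z.2).
Proof.
move=> cs opE /kify_continuousP cop; apply/kify_continuousP => K u cK cu.
apply: set_type_continuous.
have -> : set_val \o ((fun z : kify (S' * kernel)%type => op' z.1 z.2) \o u) =
    (fun z : kify (S * A)%type => op z.1 z.2) \o
      (fun y => (s (u y).1, val (u y).2)).
  by apply/funext => y /=; rewrite set_valE opE.
apply: cop cK _.
have c1 : continuous (fun y => s (u y).1).
  apply: continuous_comp_all cs.
  by apply: continuous_comp_all cu _ => z; exact: cvg_fst.
have c2 : continuous (fun y => val (u y).2).
  apply: (@continuous_comp_all _ _ _ (fun y => (u y).2) set_val).
    by apply: continuous_comp_all cu _ => z; exact: cvg_snd.
  exact: set_val_continuous.
by move=> y; apply: cvg_pair; [exact: c1|exact: c2].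
Qed.

Lemma kernel_add_continuous :
  continuous (fun z : kify (kernel * kernel)%type => z.1 + z.2 : kernel).
Proof.
apply: (@kernel_op_continuous _ _ (set_val : kernel -> A) +%R +%R) => //.
- exact: set_val_continuous.
- exact: krg_add_continuous.
Qed.

Lemma kernel_scale_continuous :
  continuous (fun z : kify (discrete_topology R * kernel)%type =>
    (z.1 : R) *: (z.2 : kernel)).
Proof.
apply: (@kernel_op_continuous _ (discrete_topology R) id
  (fun a : R => *:%R a) (fun a : R => *:%R a)) => // [x|].
  exact: cvg_id.
exact: krg_scale_continuous.
Qed.

Lemma kernel_act_continuous :
  continuous (fun z : kify (G * kernel)%type => gact z.1 z.2 : kernel).
Proof.
apply: (@kernel_op_continuous _ G id (@gact R G A) (@gact R G kernel)) => // [x|].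
  exact: cvg_id.
exact: krg_act_continuous.
Qed.

HB.instance Definition _ := RGModule_isKRGModule.Build R G kernel
  kernel_k_space kernel_add_continuous kernel_scale_continuous
  kernel_act_continuous.

End kernel.

Section relative_homological_algebra.
Context (R : comPzRingType) (G : topGroupType).
Implicit Types A B F P Q : kRGModType R G.

(* [eta] exhibits [F] as the free k-[R[G]]-module on [Y], by the universal
   property of the value at [Y] of the left adjoint of the forgetful functor. *)
Definition free_on (Y : topologicalType) F (eta : Y -> F) : Prop :=
  continuous eta /\
  forall (N : kRGModType R G) (h : Y -> N), continuous h ->
    exists phi : khom F N,
      (forall y, phi (eta y) = h y) /\
      forall psi : khom F N, (forall y, psi (eta y) = h y) -> psi =1 phi.

Definition direct_summand P F : Prop :=
  exists (Q : kRGModType R G) (iP : khom P F) (pP : khom F P)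
      (iQ : khom Q F) (pQ : khom F Q),
    [/\ forall x, pP (iP x) = x, forall x, pQ (iQ x) = x,
        forall x, pQ (iP x) = 0, forall x, pP (iQ x) = 0 &
        forall y, iP (pP y) + iQ (pQ y) = y].

Definition projective P : Prop :=
  exists (I : choiceType) (K : I -> topologicalType)
      (F : kRGModType R G) (eta : {i : I & K i} -> F),
    [/\ forall i, compact_hausdorff (K i), free_on eta & direct_summand P F].

Definition CH_split A B (f : khom A B) : Prop :=
  forall P, projective P -> forall g : khom P B,
    exists h : khom P A, forall x, f (h x) = g x.

Definition compactly_generated A : Prop :=
  exists (K : topologicalType) (F : kRGModType R G) (eta : K -> F)
      (f : khom F A),
    [/\ compact_hausdorff K, free_on eta & CH_split f].

End relative_homological_algebra.

Definition exact_at (A B C : nmodType) (f : A -> B) (g : B -> C) : Prop :=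
  forall y, g y = 0 <-> exists x, f x = y.

(* The target of [d_i : P_i -> P_(i-1)], where [P_(-1)] is [A]. *)
Definition augmented (T : Type) (A : T) (P : nat -> T) (i : nat) : T :=
  if i is j.+1 then P j else A.

(* [None] encodes infinity. *)
Definition le_natinf (i : nat) (n : option nat) : Prop :=
  if n is Some m then (i <= m)%N else True.

Section types.
Context (R : comPzRingType) (G : topGroupType).

Definition projective_resolution (A : kRGModType R G)
    (P : nat -> kRGModType R G)
    (d : forall i, khom (P i) (augmented A P i)) : Prop :=
  [/\ forall i, projective (P i),
      forall a : A, exists x, d 0%N x = a,
      forall i, exact_at (d i.+1) (d i : P i -> augmented A P i),
      CH_split (d 0%N) &
      forall i, exists e : khom (P i.+1) (kernel (d i)),
        (forall x, val (e x) = d i.+1 x) /\ CH_split e].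

Definition type_KP (n : option nat) (A : kRGModType R G) : Prop :=
  exists (P : nat -> kRGModType R G)
      (d : forall i, khom (P i) (augmented A P i)),
    projective_resolution d /\
    forall i, le_natinf i n -> compactly_generated (P i).

Definition group_action (W : Type) (act : G -> W -> W) : Prop :=
  (forall w, act 1%g w = w) /\
  forall g h w, act (g * h)%g w = act g (act h w).

Definition is_basis (W : choiceType) (P : lmodType R) (e : W -> P) : Prop :=
  (forall x, exists (s : seq W) (c : W -> R), x = \sum_(w <- s) c w *: e w) /\
  (forall (s : seq W) (c : W -> R),
     uniq s -> \sum_(w <- s) c w *: e w = 0 -> forall w, w \in s -> c w = 0).

Definition proper_discrete_permutation (P : rgModType R G) : Prop :=
  exists (W : choiceType) (act : G -> W -> W) (e : W -> P),
    [/\ group_action act,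
        forall w, compact [set g | act g w = w] /\ open [set g | act g w = w],
        is_basis e &
        forall g w, e (act g w) = gact g (e w)].

Definition finitely_generated (P : rgModType R G) : Prop :=
  exists S : seq P, forall x, exists t : seq (R * G * P),
    (forall a, a \in t -> a.2 \in S) /\
    x = \sum_(a <- t) a.1.1 *: gact a.1.2 a.2.

Definition type_FP (n : option nat) (M : rgModType R G) : Prop :=
  exists (P : nat -> rgModType R G)
      (d : forall i, P i -> augmented M P i),
    [/\ forall i, rg_morphism (d i),
        forall m : M, exists x, d 0%N x = m,
        forall i, exact_at (d i.+1) (d i : P i -> augmented M P i),
        forall i, proper_discrete_permutation (P i) &
        forall i, le_natinf i n -> finitely_generated (P i)].

End types.

(* Main.v *)
Require Import Defs.
From HB Require Import structures.
From mathcomp Require Import all_boot all_order all_algebra.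
From mathcomp Require Import all_classical all_reals topology.

Set Implicit Arguments.
Unset Strict Implicit.
Unset Printing Implicit Defensive.

Import GRing.Theory.

Local Open Scope classical_set_scope.
Local Open Scope quotient_scope.
Local Open Scope ring_scope.

(** Both finiteness conditions are read off resolutions, and the two kinds of
    building blocks are compared first.

    A proper discrete permutation module [R[W]], with the discrete topology,
    has a projective resolution by free modules on sums of profinite spaces,
    one summand for each orbit of [W]; if [R[W]] is finitely generated and
    [R] is not zero, there are finitely many orbits, so the sums are compact and
    [R[W]] has type [KP] in every degree ([permutation_KP]).  For [W = G/U] with
    [U] compact open this is the bar resolution, whose terms are the free
    modules on the powers of [U].  It splits over [R] although not over [R[G]],
    and the splittings have to be continuous in order to make the maps CH-split
    ([next_stage]).  Continuous linear maps out of a free module that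
    do not respect the action come from a universal property relative to the
    coinduced module of continuous maps from [G] ([free_linear_extension]);
    here local compactness of [G] enters.

    The rest is relative homological algebra.  [KP m A] says that [A] can be
    resolved by projectives of which the first [m] are compactly generated; it
    is stable under extensions by the horseshoe lemma ([KP_extension]), passes
    to quotients and to kernels with the expected shift ([KP_quotient],
    [KP_kernel]), and a resolution by modules of type [KP] can be replaced by
    one by projectives ([KP_resolvable]).

    If [M] has type [FP_n], apply the last fact to its resolution by
    permutation modules: a surjection onto a discrete module is CH-split, as
    every function on a discrete space is continuous.  Conversely, if [M] is
    discrete and compactly generated, the image of a compact space of
    generators is finite, so [M] is finitely generated.  By van Dantzig's
    theorem ([van_dantzig]) the stabilisers of the generators contain compact
    open subgroups, which gives a surjection onto [M] from a finitely generated
    permutation module ([permutation_cover]).  Its kernel is again discrete,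
    and has type [KP_(n-1)] by [KP_kernel]; iterate.

    Free modules on arbitrary spaces and the topologies on the other modules
    are obtained from one construction, [generated_space]: prescribe which maps
    from compact Hausdorff spaces should be continuous, and take the finest
    topology allowing them. *)

(** * Compact open subgroups *)

(** Otherwise the sets [C `&` A] generate a proper filter, and a cluster point
    of it in [C] lies in every [A]. *)
Lemma finite_directed_compact (X : topologicalType) (D : set (set X)) (C : set X) :
  D setT -> (forall A B, D A -> D B -> D (A `&` B)) ->
  (forall A, D A -> closed A) ->
  compact C -> C `&` \bigcap_(A in D) A = set0 -> exists2 A, D A & C `&` A = set0.
Proof.
move=> DT DI Dc cC CD; apply: contrapT => nD.
pose F : set_system X := filter_from D (fun A => C `&` A).
have FF : ProperFilter F.
  apply: filter_from_proper.
    apply: filter_from_filter; first by exists setT.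
    move=> A B DA DB; exists (A `&` B); first exact: DI.
    by move=> x [Cx [Ax Bx]].
  move=> A DA; apply/set0P/eqP => A0; apply: nD; by exists A.
have [|p [Cp clp]] := cC F FF; first by exists setT => // x [].
suff : (C `&` \bigcap_(A in D) A) p by rewrite CD.
split=> // A DA; apply: (Dc A DA) => V Vp.
by have [|q [[_ Aq] Vq]] := clp (C `&` A) V _ Vp; [exists A|exists q].
Qed.

(** The intersection [Q] of the clopen sets containing [x] is connected: two
    separated pieces of [Q] have a neighbourhood of one of them whose boundary
    misses [Q], hence misses some clopen set [A] containing [x]; then [A] cut
    by that neighbourhood is clopen and loses the other piece. *)
Lemma compact_totally_disconnected_zero_dimensional (X : topologicalType) :
  hausdorff_space X -> compact [set: X] -> totally_disconnected [set: X] ->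
  zero_dimensional X.
Proof.
move=> hX cX dX x y xy; apply: contrapT => nU.
pose D : set (set X) := [set A | clopen A /\ A x].
have DT : D setT by split=> //; exact: clopenT.
have DI A B : D A -> D B -> D (A `&` B).
  by move=> [cA Ax] [cB Bx]; split; [exact: clopenI|].
have Dc A : D A -> closed A by case=> -[].
pose Q := \bigcap_(A in D) A.
have cQ : closed Q by apply: closed_bigI => A /Dc.
have Qx : Q x by move=> A [].
have Qy : Q y.
  move=> A [cA Ax]; apply: contrapT => nAy; apply: nU; by exists A.
suff conQ : connected Q.
  have : connected_component setT x y by exists Q.
  by rewrite dX //= => yx; rewrite yx eqxx in xy.
apply: contrapT => /connectedPn [E [E0 QE sE]].
have disj := separated_disjoint sE.
have cE b : closed (E b).
  move: sE => [s1 s2]; apply/closure_id/seteqP; split; first exact: subset_closure.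
  have EQ : E b `<=` Q by rewrite QE; case: b => z; [right|left].
  have := closureS EQ; have /closure_id <- := cQ.
  rewrite QE => sub z cz; case: b cz EQ sub => cz EQ sub.
    have [Ez|//] := sub z cz.
    by have : (E false `&` closure (E true)) z by []; rewrite s2.
  have [//|Ez] := sub z cz.
  by have : (closure (E false) `&` E true) z by []; rewrite s1.
have [b Ebx] : exists b, E b x.
  by move: Qx; rewrite QE => -[]; [exists false|exists true].
have disjb : E b `&` E (~~ b) = set0 by case: (b); rewrite //= setIC.
have nsE : set_nbhs (E b) (~` E (~~ b)).
  apply/set_nbhsP; exists (~` E (~~ b)); split=> //; first exact: closed_openC.
  by move=> z Ez nEz; have : (E b `&` E (~~ b)) z by []; rewrite disjb.
have [U /set_nbhsP[V [oV EV VU]] clU] := compact_normal hX cX (cE b) nsE.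
(* [W] contains the boundary of the neighbourhood [V]. *)
pose W := closure U `\` V.
have cW : compact W.
  apply: (subclosed_compact _ cX) => //; apply: closedI.
    exact: closed_closure.
  exact: open_closedC.
have WQ : W `&` Q = set0.
  rewrite -subset0 => z [[Uz nVz] Qz]; move: Qz; rewrite QE.
  have : E b z -> False by move/EV.
  have : E (~~ b) z -> False by apply: clU.
  by case: (b) => /= ? ? -[].
have [A DA WA] := finite_directed_compact DT DI Dc cW WQ.
have AV : A `&` V = A `&` closure U.
  apply/seteqP; split=> z [Az Vz]; split=> //.
    exact/subset_closure/VU.
  apply: contrapT => nVz; suff : (W `&` A) z by rewrite WA.
  by split.
have DAV : D (A `&` V).
  case: DA => -[oA cA] Ax; split; last by split=> //; exact: EV.
  split; first exact: openI.
  by rewrite AV; apply: closedI => //; exact: closed_closure.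
have [z Ez] := E0 (~~ b).
have Qz : Q z by rewrite QE; case: (b) Ez => /=; [left|right].
have [_ Vz] := Qz _ DAV.
by apply: (clU z) => //; apply/subset_closure/VU.
Qed.

Lemma set_type_compact (X : topologicalType) (A : set X) :
  compact A -> compact [set: A].
Proof.
move=> cpA F FF _.
have FA : (set_val @ F) A.
  by apply: (@filterE _ F) => a; have /set_mem := valP a.
have [p [Ap clp]] := cpA (set_val @ F) _ FA.
exists (exist _ p (mem_set Ap)); split=> // U V FU.
rewrite nbhsE => -[_ [[W oW <-] /= Wp] sWV].
have FU' : (set_val @ F) (set_val @` U).
  by apply: (@filterS _ F _ U) => // a Ua; exists a.
have [x [[y Uy yx] Wx]] := clp _ W FU' (open_nbhs_nbhs (conj oW Wp)).
by exists y; split=> //; apply: sWV; rewrite /= yx.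
Qed.

Lemma hausdorff_injective (X Y : topologicalType) (f : X -> Y) :
  continuous f -> injective f -> hausdorff_space Y -> hausdorff_space X.
Proof.
move=> cf fI hY p q cpq; apply: fI; apply: hY => U V Up Vq.
have [x [Ux Vx]] := cpq _ _ (cf _ _ Up) (cf _ _ Vq).
by exists (f x).
Qed.

Lemma compact_hausdorff_set_type (X : topologicalType) (A : set X) :
  hausdorff_space X -> compact A -> compact_hausdorff A.
Proof.
move=> hX cA; split; first exact: set_type_compact.
by apply: hausdorff_injective hX; [exact: set_val_continuous|exact: val_inj].
Qed.

Lemma hausdorff_prod (X Y : topologicalType) :
  hausdorff_space X -> hausdorff_space Y -> hausdorff_space (X * Y)%type.
Proof.
move=> hX hY [p1 p2] [q1 q2] cpq; congr pair.
  apply: hX => U V Up Vq.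
  have [|| [x1 x2] [/= ? ?]] := cpq (fst @^-1` U) (fst @^-1` V).
  - exact: cvg_fst Up.
  - exact: cvg_fst Vq.
  - by exists x1.
apply: hY => U V Up Vq.
have [|| [x1 x2] [/= ? ?]] := cpq (snd @^-1` U) (snd @^-1` V).
- exact: cvg_snd Up.
- exact: cvg_snd Vq.
- by exists x2.
Qed.

Lemma compact_hausdorff_prod (X Y : topologicalType) :
  compact_hausdorff X -> compact_hausdorff Y -> compact_hausdorff (X * Y)%type.
Proof.
move=> [cX hX] [cY hY]; split; last exact: hausdorff_prod.
by rewrite -setXTT; exact: compact_setX.
Qed.

Lemma compact_hausdorff_sum (I : choiceType) (X : I -> topologicalType) :
  finite_set [set: I] -> (forall i, compact_hausdorff (X i)) ->
  compact_hausdorff {i & X i}.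
Proof.
move=> fI hX; split; first by apply: sigT_compact => // i; case: (hX i).
by apply: sigT_hausdorff => i; case: (hX i).
Qed.

(** The tube lemma. *)
Lemma open_forall_compact (X Y : topologicalType) (B : set Y) (W : set (X * Y)) :
  compact B -> open W -> open [set a | forall b, B b -> W (a, b)].
Proof.
move=> /compact_near_coveringP cB oW; rewrite openE => a Wa.
have /= := cB _ (nbhs a) (fun a' b => W (a', b)) _; apply=> b Bb.
have : nbhs (a, b) W by apply: open_nbhs_nbhs; split=> //; exact: Wa.
case=> -[U V] /= [Ua Vb] UVW.
by exists (V, U) => // -[b' a'] [/= Vb' Ua']; apply: UVW.
Qed.

(** Work in a compact neighbourhood [K] of [x], which is zero-dimensional: a
    clopen subset of [K] that lies in the interior of [K] is open in [X]. *)
Lemma compact_open_nbhs (X : topologicalType) (x : X) (V : set X) :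
  hausdorff_space X -> locally_compact [set: X] ->
  totally_disconnected [set: X] -> nbhs x V ->
  exists C : set X, [/\ compact C, open C, C x & C `<=` V].
Proof.
move=> hX lX dX Vx.
have [K Kx cK] : exists2 K, nbhs x K & compact K.
  by have [D] := lX x I; rewrite withinET => xD [cD _]; exists D.
have [cKT hK] := compact_hausdorff_set_type hX cK.
have dK : totally_disconnected [set: K].
  move=> z _; apply/seteqP; split; last first.
    by move=> _ ->; exact: connected_component_refl.
  move=> y [B [Bz _ cB] By]; apply: val_inj.
  suff : connected_component setT (val z) (val y) by rewrite dX.
  exists (set_val @` B); last by exists y.
  split => //; first by exists z.
  apply: connected_continuous_connected cB _.
  by apply: continuous_subspaceT; exact: set_val_continuous.
have zK := compact_totally_disconnected_zero_dimensional hK cKT dK.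
have Kx0 := nbhs_singleton Kx.
pose x' : K := exist _ x (mem_set Kx0).
have nV : nbhs x' (set_val @^-1` (V `&` K)°).
  apply: set_val_continuous; apply: open_nbhs_nbhs; split.
    exact: open_interior.
  by apply: filterI.
have [D [Dx [oD cD]] DV] := zero_dimensional_cvg (x := x') hK zK cKT nV.
have DE : set_val @` D `<=` (V `&` K)° by move=> _ [z Dz <-]; exact: DV.
exists (set_val @` D); split.
- apply: continuous_compact; last exact: subclosed_compact cKT _.
  by apply: continuous_subspaceT; exact: set_val_continuous.
- case: oD => O oO OD.
  suff -> : set_val @` D = O `&` (V `&` K)° by apply: openI => //; exact: open_interior.
  apply/seteqP; split=> [_ [z Dz <-]|y [Oy VKy]].
    by split; [rewrite -OD in Dz|apply: DV].
  have [_ Ky] := interior_subset VKy.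
  by exists (exist _ y (mem_set Ky)) => //; rewrite -OD.
- by exists x'.
- by move=> y /DE /interior_subset [].
Qed.

Section topological_group.
Context (G : topGroupType).

Lemma mul_continuous (X : topologicalType) (f h : X -> G) :
  continuous f -> continuous h -> continuous (fun x => (f x * h x)%g).
Proof.
move=> cf ch x; apply: (@continuous_comp _ _ _ (fun x => (f x, h x))
  (fun z : G * G => (z.1 * z.2)%g)); last exact: mulg_continuous.
by apply: cvg_pair; [exact: cf|exact: ch].
Qed.

Lemma inv_continuous (X : topologicalType) (f : X -> G) :
  continuous f -> continuous (fun x => ((f x)^-1)%g).
Proof.
by move=> cf; apply: continuous_comp_all cf _; exact: invg_continuous.
Qed.

Lemma open_translate (U : set G) (g : G) :
  open U -> open [set h | U (g^-1 * h)%g].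
Proof.
apply: open_comp => h _; apply: mul_continuous => y; first exact: cvg_cst.
exact: cvg_id.
Qed.

Definition open_subgroup (U : set G) : Prop :=
  [/\ open U, U 1%g, forall g h, U g -> U h -> U (g * h)%g &
      forall g, U g -> U (g^-1)%g].

(** The left stabiliser of a compact open neighbourhood [K] of [1] is a
    subgroup, lies in [K], and is open by the tube lemma. *)
Lemma van_dantzig (V : set G) : tdlc G -> nbhs (1%g : G) V ->
  exists U : set G, [/\ compact U, open_subgroup U & U `<=` V].
Proof.
move=> [hG lG dG] V1.
have [K [cK oK K1 KV]] := compact_open_nbhs hG lG dG V1.
pose U : set G := [set g | forall k, K k -> K (g * k)%g /\ K (g^-1 * k)%g].
have UK : U `<=` K by move=> g /(_ _ K1) []; rewrite mulg1.
have clK := compact_closed hG cK.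
exists U; split; [|split|by move=> g /UK /KV].
- apply: (subclosed_compact _ cK) => //.
  have -> : U = \bigcap_(k in K) ([set g | K (g * k)%g] `&` [set g | K (g^-1 * k)%g]).
    by apply/seteqP; split.
  apply: closed_bigI => k _; apply: closedI.
    apply: (@continuous_closed_preimage _ _ (fun g : G => (g * k)%g)) => //.
    by apply: mul_continuous => y; [exact: cvg_id|exact: cvg_cst].
  apply: (@continuous_closed_preimage _ _ (fun g : G => (g^-1 * k)%g)) => //.
  apply: mul_continuous => y; last exact: cvg_cst.
  exact: invg_continuous.
- apply: (@open_forall_compact _ _ K
    [set z : G * G | K (z.1 * z.2)%g /\ K (z.1^-1 * z.2)%g]) => //.
  have cf : continuous (@fst G G) by move=> z; exact: cvg_fst.
  have cs : continuous (@snd G G) by move=> z; exact: cvg_snd.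
  apply: openI.
    apply: (@open_comp _ _ (fun z : G * G => (z.1 * z.2)%g)) => // z _.
    exact: mulg_continuous.
  apply: (@open_comp _ _ (fun z : G * G => (z.1^-1 * z.2)%g)) => // z _.
  by apply: mul_continuous cs _; exact: inv_continuous.
- by move=> k Kk; rewrite invg1 mul1g.
- move=> g h Ug Uh k Kk; rewrite invgM -!mulgA; split.
    by case: (Uh _ Kk) => /Ug [].
  by case: (Ug _ Kk) => _ /Uh [].
- by move=> g Ug k /Ug []; rewrite invgK.
Qed.

End topological_group.

(** * k-spaces and generated topologies *)

Lemma id_continuous_all (X : topologicalType) : continuous (@id X).
Proof. by move=> x; exact: cvg_id. Qed.

Lemma continuous_pair (X Y Z : topologicalType) (f : X -> Y) (g : X -> Z) :
  continuous f -> continuous g -> continuous (fun x => (f x, g x)).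
Proof. by move=> cf cg x; apply: cvg_pair; [exact: cf|exact: cg]. Qed.

Lemma continuous_comp_fst (X A B : topologicalType) (u : X -> (A * B)%type) :
  continuous u -> continuous (fun x => (u x).1).
Proof. by move=> cu; apply: continuous_comp_all cu _ => z; exact: cvg_fst. Qed.

Lemma continuous_comp_snd (X A B : topologicalType) (u : X -> (A * B)%type) :
  continuous u -> continuous (fun x => (u x).2).
Proof. by move=> cu; apply: continuous_comp_all cu _ => z; exact: cvg_snd. Qed.

Lemma continuous_from_cg (X Y : topologicalType) (f : X -> Y) :
  compactly_generated_space X ->
  (forall (K : topologicalType) (u : K -> X),
     compact_hausdorff K -> continuous u -> continuous (f \o u)) ->
  continuous f.
Proof.
move=> gX cf; apply/continuousP => U oU; rewrite -closedC; apply: gX => K u cK cu.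
rewrite preimage_setC -comp_preimage; apply: open_closedC.
by have /continuousP := cf K u cK cu; apply.
Qed.

Lemma locally_compact_compactly_generated (X : topologicalType) :
  hausdorff_space X -> (forall x : X, exists2 C, nbhs x C & compact C) ->
  compactly_generated_space X.
Proof.
move=> hX lX A cA; rewrite -openC openE => x nAx.
have [C Cx cC] := lX x.
have cAC : closed (A `&` C).
  apply: compact_closed => //.
  have -> : A `&` C = set_val @` (set_val @^-1` A : set C).
    apply/seteqP; split=> [y [Ay Cy]|_ [y Ay <-]]; last first.
      by split=> //; exact: set_mem (valP y).
    by exists (exist _ y (mem_set Cy)).
  have [cCT hC] := compact_hausdorff_set_type hX cC.
  apply: continuous_compact.
    by apply: continuous_subspaceT; exact: set_val_continuous.
  apply: (subclosed_compact _ cCT) => //; apply: cA => //.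
  exact: set_val_continuous.
have : nbhs x (C `&` ~` (A `&` C)).
  apply: filterI => //; apply: open_nbhs_nbhs; split; last by case.
  exact: closed_openC.
by apply: filterS => y [Cy nACy] Ay; apply: nACy.
Qed.

Lemma tdlc_compact_nbhs (G : topGroupType) (x : G) :
  tdlc G -> exists2 C, nbhs x C & compact C.
Proof.
move=> [hG lG dG].
have [C [cC oC Cx _]] := compact_open_nbhs hG lG dG (@filterT _ (nbhs x) _).
by exists C => //; exact: open_nbhs_nbhs.
Qed.

Lemma tdlc_compactly_generated (G : topGroupType) :
  tdlc G -> compactly_generated_space G.
Proof.
move=> hG; have [hausG _ _] := hG.
by apply: locally_compact_compactly_generated => // x; exact: tdlc_compact_nbhs.
Qed.

Lemma compact_times_tdlc_compactly_generated (K : topologicalType)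
    (G : topGroupType) :
  compact_hausdorff K -> tdlc G -> compactly_generated_space (K * G)%type.
Proof.
move=> [cK hK] hG; have [hausG _ _] := hG.
apply: locally_compact_compactly_generated; first exact: hausdorff_prod.
move=> [k g]; have [C Cg cC] := tdlc_compact_nbhs g hG.
exists (setT `*` C); last exact: compact_setX.
by exists (setT, C) => //; split => //; exact: filterT.
Qed.

Lemma unit_compact_hausdorff : compact_hausdorff (discrete_topology unit).
Proof.
split; last exact: discrete_hausdorff.
rewrite (_ : [set: _] = [set tt]); first exact: compact_set1.
by apply/seteqP; split=> [[]|].
Qed.

(** Weak Hausdorffness is only about the closedness of images of compact
    spaces.  If [u a <> v b], normality of [K] splits the image of [u] into two
    closed sets, one missing [u a] and the other missing [v b]. *)
Lemma closed_coincidence (N K L : topologicalType) (u : K -> N) (v : L -> N) :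
  k_space N -> compact_hausdorff K -> continuous u -> continuous v ->
  closed [set z : K * L | u z.1 = v z.2].
Proof.
move=> kN [cK hK] cu cv; have [_ wN] := kN.
have imc (A : set K) : closed A -> closed (u @` A).
  move=> cA; have := wN _ _ (set_type_compact_hausdorff (conj cK hK) cA)
    (continuous_comp_all (@set_val_continuous _ _) cu).
  congr closed; apply/seteqP; split=> [_ [a _ <-]|_ [a Aa <-]].
    by exists (set_val a) => //; exact: set_mem (valP a).
  by exists (exist _ a (mem_set Aa)).
rewrite -openC openE => -[a b] /= uv.
have cp (p : N) : closed (u @^-1` [set p]).
  by apply: continuous_closed_preimage cu _; exact: closed_set1_k.
have nsA : set_nbhs (u @^-1` [set u a]) (~` (u @^-1` [set v b])).
  apply/set_nbhsP; exists (~` (u @^-1` [set v b])); split=> //.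
    exact: closed_openC.
  by move=> x /= ->.
have [V /set_nbhsP[W [oW AW WV]] clV] := compact_normal hK cK (cp _) nsA.
have oC : open (~` (u @` ~` W)) by apply: closed_openC; apply: imc; exact: open_closedC.
have oD : open (~` (u @` closure V)).
  by apply: closed_openC; apply: imc; exact: closed_closure.
exists (u @^-1` (~` (u @` ~` W)), v @^-1` (~` (u @` closure V))).
  split=> /=.
    apply: cu; apply: open_nbhs_nbhs; split=> // -[x nWx uxa].
    by apply: nWx; exact: AW.
  apply: cv; apply: open_nbhs_nbhs; split=> // -[x Vx uxb].
  by apply: (clV x Vx).
move=> [a' b'] /= [Ca Db] e; have [Wa|nWa] := pselect (W a').
  by apply: Db; exists a' => //; exact/subset_closure/WV.
by apply: Ca; exists a'.
Qed.

Lemma sum_compactly_generated (I : choiceType) (K : I -> topologicalType) :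
  (forall i, compactly_generated_space (K i)) ->
  compactly_generated_space {i & K i}.
Proof.
move=> gK A cA; rewrite -openC; apply/sigT_openP => i.
rewrite preimage_setC; apply: closed_openC; apply: gK => L u cL cu.
apply: (cA L (existT K i \o u)) => //.
exact: continuous_comp_all cu (@existT_continuous _ _ i).
Qed.

Lemma compact_hausdorff_compactly_generated (K : topologicalType) :
  compact_hausdorff K -> compactly_generated_space K.
Proof. by move=> cK A cA; apply: (cA K id) => //; exact: id_continuous_all. Qed.

(** [adm] selects the maps from compact Hausdorff spaces which have to be
    continuous.  The topology is the finest one, so [generated_space] is always
    compactly generated. *)
Definition generated_space (T : choiceType)
  (adm : forall K : topologicalType, (K -> T) -> Prop) : Type := T.

Section generated_space.
Context (T : choiceType) (adm : forall K : topologicalType, (K -> T) -> Prop).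
Local Notation generated_space := (generated_space adm).

HB.instance Definition _ := Choice.copy generated_space T.

Definition generated_open (U : set generated_space) : Prop :=
  forall (K : topologicalType) (u : K -> T),
    compact_hausdorff K -> adm u -> open (u @^-1` U).

Lemma generated_openT : generated_open [set: generated_space].
Proof. by move=> K u _ _; rewrite preimage_setT; exact: openT. Qed.

Lemma generated_openI : setI_closed generated_open.
Proof.
by move=> U V oU oV K u cK cu; rewrite preimage_setI; apply: openI; auto.
Qed.

Lemma generated_open_bigU (I : Type) (f : I -> set generated_space) :
  (forall i, generated_open (f i)) -> generated_open (\bigcup_i f i).
Proof.
move=> of_ K u cK cu; rewrite preimage_bigcup; apply: bigcup_open => i _.
exact: of_.
Qed.

HB.instance Definition _ := isOpenTopological.Build generated_space
  generated_openT generated_openI generated_open_bigU.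

Lemma generated_openE : @open generated_space = generated_open.
Proof. by []. Qed.

Lemma generated_admissible (K : topologicalType) (u : K -> generated_space) :
  compact_hausdorff K -> adm u -> continuous u.
Proof. by move=> cK au; apply/continuousP => U; rewrite generated_openE; apply. Qed.

Lemma generated_continuous (Z : topologicalType) (f : generated_space -> Z) :
  (forall (K : topologicalType) (u : K -> generated_space),
     compact_hausdorff K -> adm u -> continuous (f \o u)) -> continuous f.
Proof.
move=> fK; apply/continuousP => U oU; rewrite generated_openE => K u cK cu.
by rewrite -comp_preimage; have /continuousP := fK K u cK cu; apply.
Qed.

(** Points separated by continuous maps to k-spaces suffice for weak
    Hausdorffness: the coincidence set of two maps from compact spaces is then
    an intersection of closed sets, and the image of one map pulls back along
    the other to a projection of this set along a compact space. *)
Lemma generated_k_space :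
  (forall x y : generated_space,
     (forall (N : topologicalType) (f : generated_space -> N),
       k_space N -> continuous f -> f x = f y) -> x = y) ->
  k_space generated_space.
Proof.
move=> sep.
have cg : compactly_generated_space generated_space.
  move=> A cA; rewrite -openC generated_openE => K u cK au.
  rewrite preimage_setC; apply: closed_openC; apply: cA => //.
  exact: generated_admissible.
split=> // K u cK cu; apply: cg => L v cL cv.
rewrite -openC.
have -> : ~` (v @^-1` range u) =
    [set b | forall a : K, [set: K] a -> (~` [set z : L * K | u z.2 = v z.1]) (b, a)].
  apply/seteqP; split=> b /= Hb; first by move=> a _ uv; apply: Hb; exists a.
  by move=> [a _ uv]; exact: (Hb a).
apply: open_forall_compact; first by case: cK.
rewrite openE => -[b a] /= nuv.
have [[N [f [kN cf fuv]]]|nN] := pselect (exists (N : topologicalType)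
    (f : generated_space -> N), [/\ k_space N, continuous f & f (u a) <> f (v b)]).
  have : open (~` [set z : L * K | f (v z.1) = f (u z.2)]).
    apply: closed_openC; apply: (@closed_coincidence N L K (f \o v) (f \o u)) => //.
      exact: continuous_comp_all cv cf.
    exact: continuous_comp_all cu cf.
  rewrite openE => /(_ (b, a)) /= /(_ (fun e => fuv (esym e))).
  by apply: filterS => -[b' a'] /= fvu uv; apply: fvu; rewrite uv.
exfalso; apply: nuv; apply: sep => N f kN cf; apply: contrapT => fuv.
by apply: nN; exists N, f.
Qed.

End generated_space.

(** * Linear maps and continuity of module operations *)

Section linear_maps.
Context (R : comPzRingType) (A B : lmodType R) (f : A -> B) (fL : linear f).

Lemma is_linear_D x y : f (x + y) = f x + f y.
Proof. by have := fL 1 x y; rewrite !scale1r. Qed.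

Lemma is_linear_0 : f 0 = 0.
Proof. by apply: (addrI (f 0)); rewrite -is_linear_D !addr0. Qed.

Lemma is_linear_Z a x : f (a *: x) = a *: f x.
Proof. by have := fL a x 0; rewrite is_linear_0 !addr0. Qed.

Lemma is_linear_N x : f (- x) = - f x.
Proof. by rewrite -!scaleN1r is_linear_Z. Qed.

Lemma is_linear_B x y : f (x - y) = f x - f y.
Proof. by rewrite is_linear_D is_linear_N. Qed.

Lemma is_linear_sum (I : Type) (s : seq I) (F : I -> A) :
  f (\sum_(i <- s) F i) = \sum_(i <- s) f (F i).
Proof. exact: (big_morph f is_linear_D is_linear_0). Qed.

End linear_maps.


Section continuity.
Context (R : comPzRingType) (G : topGroupType) (N : kRGModType R G).
Context (K : topologicalType) (cK : compact_hausdorff K).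

Lemma continuous_krg_add (f g : K -> N) :
  continuous f -> continuous g -> continuous (fun k => f k + g k).
Proof.
move=> cf cg; have /kify_continuousP := @krg_add_continuous R G N.
by move=> /(_ K (fun k => (f k, g k)) cK); apply; exact: continuous_pair.
Qed.

Lemma continuous_krg_scale (a : R) (f : K -> N) :
  continuous f -> continuous (fun k => a *: f k).
Proof.
move=> cf; have /kify_continuousP := @krg_scale_continuous R G N.
move=> /(_ K (fun k => ((a : discrete_topology R), f k)) cK); apply.
by apply: continuous_pair => // x; exact: cvg_cst.
Qed.

Lemma continuous_krg_scale2 (a : K -> discrete_topology R) (f : K -> N) :
  continuous a -> continuous f -> continuous (fun k => (a k : R) *: f k).
Proof.
move=> ca cf; have /kify_continuousP := @krg_scale_continuous R G N.
by move=> /(_ K (fun k => (a k, f k)) cK); apply; exact: continuous_pair.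
Qed.

Lemma continuous_krg_act (g : K -> G) (f : K -> N) :
  continuous g -> continuous f -> continuous (fun k => gact (g k) (f k)).
Proof.
move=> cg cf; have /kify_continuousP := @krg_act_continuous R G N.
by move=> /(_ K (fun k => (g k, f k)) cK); apply; exact: continuous_pair.
Qed.

End continuity.

(** * Free modules *)

Section free_module.
Context (R : comPzRingType) (G : topGroupType) (Y : topologicalType).

Definition free_eval (N : rgModType R G) (h : Y -> N)
    (s : seq (R * G * Y)) : N :=
  \sum_(a <- s) a.1.1 *: gact a.1.2 (h a.2).

(** Formal combinations are identified when no continuous map to a
    k-[R[G]]-module tells them apart.  The quantification over all modules is
    harmless since it happens in a proposition, and it makes the quotient
    universal without any explicit description. *)
Definition free_equiv (s t : seq (R * G * Y)) : bool :=
  `[< forall (N : kRGModType R G) (h : Y -> N), continuous h ->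
        free_eval h s = free_eval h t >].

Lemma free_equiv_refl : reflexive free_equiv.
Proof. by move=> s; apply/asboolP. Qed.

Lemma free_equiv_sym : symmetric free_equiv.
Proof.
by move=> s t; apply/asboolP/asboolP => st N h ch; rewrite st.
Qed.

Lemma free_equiv_trans : transitive free_equiv.
Proof.
move=> t s w /asboolP st /asboolP tw; apply/asboolP => N h ch.
by rewrite st // tw.
Qed.

Canonical free_equiv_rel :=
  EquivRel free_equiv free_equiv_refl free_equiv_sym free_equiv_trans.

Definition free_module : Type := {eq_quot free_equiv_rel}.

HB.instance Definition _ := Choice.on free_module.

Definition free_class (s : seq (R * G * Y)) : free_module :=
  \pi_{eq_quot free_equiv_rel} s.

(** The extension of [h] to the free module.  It determines elements
    ([free_ev_inj]), so each module axiom below is inherited from the modules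
    [N]. *)
Definition free_ev (N : rgModType R G) (h : Y -> N) (x : free_module) : N :=
  free_eval h (repr (x : {eq_quot free_equiv_rel})).

Lemma free_ev_class (N : kRGModType R G) (h : Y -> N) s :
  continuous h -> free_ev h (free_class s) = free_eval h s.
Proof.
move=> ch; rewrite /free_ev /free_class; case: piP => t /eqmodP /asboolP st.
exact/esym/st.
Qed.

Lemma free_ev_inj (x y : free_module) :
  (forall (N : kRGModType R G) (h : Y -> N), continuous h ->
     free_ev h x = free_ev h y) -> x = y.
Proof.
move=> xy; rewrite -[x]reprK -[y]reprK; apply/eqmodP/asboolP => N h ch.
exact: xy.
Qed.

Definition free_zero := free_class [::].
Definition free_add (x y : free_module) :=
  free_class (repr (x : {eq_quot free_equiv_rel}) ++ repr (y : {eq_quot free_equiv_rel})).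
Definition free_scale (c : R) (x : free_module) :=
  free_class [seq (c * a.1.1, a.1.2, a.2) | a <- repr (x : {eq_quot free_equiv_rel})].
Definition free_opp (x : free_module) := free_scale (-1) x.
Definition free_gact (g : G) (x : free_module) :=
  free_class [seq (a.1.1, (g * a.1.2)%g, a.2) | a <- repr (x : {eq_quot free_equiv_rel})].

Section free_ev.
Context (N : kRGModType R G) (h : Y -> N) (ch : continuous h).

Lemma free_ev0 : free_ev h free_zero = 0.
Proof. by rewrite free_ev_class // /free_eval big_nil. Qed.

Lemma free_evD x y : free_ev h (free_add x y) = free_ev h x + free_ev h y.
Proof. by rewrite free_ev_class // /free_eval big_cat. Qed.

Lemma free_evZ c x : free_ev h (free_scale c x) = c *: free_ev h x.
Proof.
rewrite free_ev_class // /free_eval big_map scaler_sumr.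
by apply: eq_bigr => a _; rewrite scalerA.
Qed.

Lemma free_evN x : free_ev h (free_opp x) = - free_ev h x.
Proof. by rewrite free_evZ scaleN1r. Qed.

Lemma free_evG g x : free_ev h (free_gact g x) = gact g (free_ev h x).
Proof.
rewrite free_ev_class // /free_eval big_map (is_linear_sum (gact_linear g)).
apply: eq_bigr => a _; rewrite (is_linear_Z (gact_linear g)) /=.
by rewrite -gactM.
Qed.

End free_ev.

Lemma free_addA : associative free_add.
Proof. by move=> x y z; apply: free_ev_inj => N h ch; rewrite !free_evD // addrA. Qed.

Lemma free_addC : commutative free_add.
Proof. by move=> x y; apply: free_ev_inj => N h ch; rewrite !free_evD // addrC. Qed.

Lemma free_add0 : left_id free_zero free_add.
Proof.
by move=> x; apply: free_ev_inj => N h ch; rewrite free_evD // free_ev0 // add0r.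
Qed.

Lemma free_addN : left_inverse free_zero free_opp free_add.
Proof.
move=> x; apply: free_ev_inj => N h ch.
by rewrite free_evD // free_ev0 // free_evN // addNr.
Qed.

HB.instance Definition _ := GRing.isZmodule.Build free_module
  free_addA free_addC free_add0 free_addN.

Lemma free_scaleA a b x : free_scale a (free_scale b x) = free_scale (a * b) x.
Proof. by apply: free_ev_inj => N h ch; rewrite !free_evZ // scalerA. Qed.

Lemma free_scale1 : left_id 1 free_scale.
Proof. by move=> x; apply: free_ev_inj => N h ch; rewrite free_evZ // scale1r. Qed.

Lemma free_scaleDr : right_distributive free_scale +%R.
Proof.
move=> a x y; apply: free_ev_inj => N h ch.
by rewrite free_evZ // !free_evD // !free_evZ // scalerDr.
Qed.

Lemma free_scaleDl x : {morph free_scale^~ x : a b / a + b}.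
Proof.
move=> a b; apply: free_ev_inj => N h ch.
by rewrite free_evZ // !free_evD // !free_evZ // scalerDl.
Qed.

HB.instance Definition _ := GRing.Zmodule_isLmodule.Build R free_module
  free_scaleA free_scale1 free_scaleDr free_scaleDl.

Lemma free_gact1 x : free_gact 1%g x = x.
Proof. by apply: free_ev_inj => N h ch; rewrite free_evG // gact1. Qed.

Lemma free_gactM g k x : free_gact (g * k)%g x = free_gact g (free_gact k x).
Proof. by apply: free_ev_inj => N h ch; rewrite !free_evG // gactM. Qed.

Lemma free_gact_linear g : linear (free_gact g).
Proof.
move=> a x y; apply: free_ev_inj => N h ch; rewrite free_evG //.
by rewrite !free_evD // !free_evZ // !free_evG // gact_linear.
Qed.

HB.instance Definition _ := Lmodule_isRGModule.Build R G free_module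
  free_gact1 free_gactM free_gact_linear.

(** The finest k-topology for which all extensions [free_ev h] can be
    continuous. *)
Definition free_admissible (K : topologicalType) (u : K -> free_module) : Prop :=
  forall (N : kRGModType R G) (h : Y -> N), continuous h ->
    continuous (fun k => free_ev h (u k)).

HB.instance Definition _ := Topological.copy free_module
  (generated_space free_admissible).

Lemma free_ev_continuous (N : kRGModType R G) (h : Y -> N) :
  continuous h -> continuous (free_ev h : free_module -> N).
Proof. by move=> ch; apply: generated_continuous => K u cK; apply. Qed.

Lemma continuous_free (K : topologicalType) (u : K -> free_module) :
  compact_hausdorff K ->
  (forall (N : kRGModType R G) (h : Y -> N), continuous h ->
    continuous (fun k => free_ev h (u k))) -> continuous u.
Proof. by move=> cK cu; apply: generated_admissible. Qed.

Lemma free_k_space : k_space free_module.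
Proof.
apply: generated_k_space => x y xy; apply: free_ev_inj => N h ch.
by apply: xy; [exact: krg_k_space|exact: free_ev_continuous].
Qed.

Lemma continuous_free_ev (K : topologicalType) (u : K -> free_module)
    (N : kRGModType R G) (h : Y -> N) :
  continuous u -> continuous h -> continuous (fun k => free_ev h (u k)).
Proof. by move=> cu ch; apply: continuous_comp_all cu _; exact: free_ev_continuous. Qed.

Lemma free_add_continuous :
  continuous (fun z : kify (free_module * free_module)%type => z.1 + z.2 : free_module).
Proof.
apply/kify_continuousP => K u cK cu; apply: continuous_free => // N h ch.
rewrite (_ : (fun k => _) = fun k => free_ev h (u k).1 + free_ev h (u k).2).
  apply: continuous_krg_add => //; apply: continuous_free_ev => //.
    exact: continuous_comp_fst.
  exact: continuous_comp_snd.
by apply/funext => k; rewrite /= free_evD.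
Qed.

Lemma free_scale_continuous :
  continuous (fun z : kify (discrete_topology R * free_module)%type =>
    (z.1 : R) *: (z.2 : free_module)).
Proof.
apply/kify_continuousP => K u cK cu; apply: continuous_free => // N h ch.
rewrite (_ : (fun k => _) = fun k => ((u k).1 : R) *: free_ev h (u k).2).
  apply: continuous_krg_scale2 => //; first exact: continuous_comp_fst.
  by apply: continuous_free_ev => //; exact: continuous_comp_snd.
by apply/funext => k; rewrite /= free_evZ.
Qed.

Lemma free_act_continuous :
  continuous (fun z : kify (G * free_module)%type => gact z.1 z.2 : free_module).
Proof.
apply/kify_continuousP => K u cK cu; apply: continuous_free => // N h ch.
rewrite (_ : (fun k => _) = fun k => gact (u k).1 (free_ev h (u k).2)).
  apply: continuous_krg_act => //; first exact: continuous_comp_fst.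
  by apply: continuous_free_ev => //; exact: continuous_comp_snd.
by apply/funext => k; rewrite /= free_evG.
Qed.

HB.instance Definition _ := RGModule_isKRGModule.Build R G free_module
  free_k_space free_add_continuous free_scale_continuous free_act_continuous.

End free_module.

(** * Morphisms *)

Section khom_theory.
Context (R : comPzRingType) (G : topGroupType).
Implicit Types A B C : kRGModType R G.

Section khom_morphism.
Context A B (f : khom A B).
Lemma khom0 : f 0 = 0. Proof. exact: is_linear_0 (khom_morphism f).1. Qed.
Lemma khomD x y : f (x + y) = f x + f y.
Proof. exact: is_linear_D (khom_morphism f).1 x y. Qed.
Lemma khomN x : f (- x) = - f x.
Proof. exact: is_linear_N (khom_morphism f).1 x. Qed.
Lemma khomB x y : f (x - y) = f x - f y.
Proof. exact: is_linear_B (khom_morphism f).1 x y. Qed.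
Lemma khomZ a x : f (a *: x) = a *: f x.
Proof. exact: is_linear_Z (khom_morphism f).1 a x. Qed.
Lemma khomG g x : f (gact g x) = gact g (f x).
Proof. exact: (khom_morphism f).2. Qed.
Lemma khom_sum (I : Type) (s : seq I) (F : I -> A) :
  f (\sum_(i <- s) F i) = \sum_(i <- s) f (F i).
Proof. exact: (is_linear_sum (khom_morphism f).1 s F). Qed.
End khom_morphism.

Lemma khom_id_morphism A : rg_morphism (@id A).
Proof. by split. Qed.

Definition khom_id A : khom A A :=
  KHom (khom_id_morphism A) (@id_continuous_all A).

Lemma khom_comp_morphism A B C (f : khom B C) (g : khom A B) :
  rg_morphism (fun x => f (g x)).
Proof.
split=> [a x y|k x]; first by rewrite !khomD !khomZ.
by rewrite !khomG.
Qed.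

Definition khom_comp A B C (f : khom B C) (g : khom A B) : khom A C :=
  KHom (khom_comp_morphism f g)
    (continuous_comp_all (@khom_continuous _ _ _ _ g) (@khom_continuous _ _ _ _ f)).

Lemma khom_lin_morphism A B (c d : R) (f g : khom A B) :
  rg_morphism (fun x => c *: f x + d *: g x).
Proof.
split=> [a x y|k x].
  rewrite !khomD !khomZ !scalerDr !scalerA ![_ * a]mulrC addrACA.
  by rewrite -!scalerA -scalerDr.
by rewrite !khomG gact_linear !(is_linear_Z (gact_linear k)).
Qed.

Lemma khom_lin_continuous A B (c d : R) (f g : khom A B) :
  continuous (fun x => c *: f x + d *: g x).
Proof.
apply: continuous_from_cg => [|K u cK cu]; first by case: (@krg_k_space R G A).
apply: (@continuous_krg_add _ _ B K cK (fun k => c *: f (u k)) (fun k => d *: g (u k))).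
  apply: continuous_krg_scale => //; apply: continuous_comp_all cu _.
  exact: khom_continuous.
apply: continuous_krg_scale => //; apply: continuous_comp_all cu _.
exact: khom_continuous.
Qed.

Definition khom_lin A B (c d : R) (f g : khom A B) : khom A B :=
  KHom (khom_lin_morphism c d f g) (@khom_lin_continuous _ _ c d f g).

Definition khom_sub A B (f g : khom A B) : khom A B := khom_lin 1 (-1) f g.

Lemma khom_subE A B (f g : khom A B) x : khom_sub f g x = f x - g x.
Proof. by rewrite /= scale1r scaleN1r. Qed.

Definition khom_add A B (f g : khom A B) : khom A B := khom_lin 1 1 f g.

Lemma khom_addE A B (f g : khom A B) x : khom_add f g x = f x + g x.
Proof. by rewrite /= !scale1r. Qed.

Lemma khom_zero_morphism A B : rg_morphism (fun _ : A => 0 : B).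
Proof.
split=> [a x y|k x]; first by rewrite scaler0 addr0.
by rewrite (is_linear_0 (gact_linear k)).
Qed.

Definition khom_zero A B : khom A B :=
  KHom (khom_zero_morphism A B) (fun x => @cvg_cst _ _ _ _ (nbhs_filter x)).

End khom_theory.

(** * The universal property of free modules *)

Section free_universal.
Context (R : comPzRingType) (G : topGroupType) (Y : topologicalType).
Local Notation F := (free_module R G Y).

Definition free_eta (y : Y) : F := free_class [:: (1, 1%g, y)].

Lemma free_ev_eta (N : kRGModType R G) (h : Y -> N) y :
  continuous h -> free_ev h (free_eta y) = h y.
Proof.
by move=> ch; rewrite free_ev_class // /free_eval big_seq1 /= scale1r gact1.
Qed.

Lemma free_eta_continuous : compactly_generated_space Y -> continuous free_eta.
Proof.
move=> gY; apply: continuous_from_cg => // K u cK cu.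
apply: continuous_free => // N h ch.
rewrite (_ : (fun k => _) = h \o u); first exact: continuous_comp_all cu ch.
by apply/funext => k; rewrite /= free_ev_eta.
Qed.

Lemma free_ev_morphism (N : kRGModType R G) (h : Y -> N) :
  continuous h -> rg_morphism (free_ev h : F -> N).
Proof.
move=> ch; split=> [a x y|g x]; last exact: free_evG.
by rewrite free_evD // free_evZ.
Qed.

Definition free_lift (N : kRGModType R G) (h : Y -> N) (ch : continuous h) :
  khom F N := KHom (free_ev_morphism ch) (free_ev_continuous ch).

Lemma free_expansion (x : F) : exists s : seq (R * G * Y),
  x = \sum_(a <- s) a.1.1 *: gact a.1.2 (free_eta a.2).
Proof.
exists (repr (x : {eq_quot free_equiv_rel R G Y})).
apply: free_ev_inj => N h ch.
rewrite -[RHS]/(free_lift ch _) khom_sum.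
by apply: eq_bigr => a _; rewrite khomZ khomG /= free_ev_eta.
Qed.

Lemma free_module_free : compactly_generated_space Y -> free_on free_eta.
Proof.
move=> gY; split; first exact: free_eta_continuous.
move=> N h ch; exists (free_lift ch); split=> [y|psi psih x].
  exact: free_ev_eta.
have [s ->] := free_expansion x.
rewrite -[RHS]/(free_lift ch _) !khom_sum; apply: eq_bigr => a _.
by rewrite !khomZ !khomG psih /= free_ev_eta.
Qed.

End free_universal.

(** * Coinduced modules and linear extension *)

Definition is_continuous_map (X Y : topologicalType) : pred (X -> Y) :=
  fun f => `[< continuous f >].

(** The continuous maps from [G] to [N], with [G] acting by right translation of
    the argument.  The hypothesis on [G] is a parameter because the module
    structure depends on it. *)
Definition coinduced (R : comPzRingType) (G : topGroupType) (hG : tdlc G)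
  (N : kRGModType R G) : Type := {f : G -> N | is_continuous_map f}.

Section coinduced.
Context (R : comPzRingType) (G : topGroupType) (hG : tdlc G) (N : kRGModType R G).
Local Notation coinduced := (coinduced hG N).

HB.instance Definition _ := SubChoice.on coinduced.

Lemma continuous_map_closed :
  subsemimod_closed (fun f : G -> N => is_continuous_map f).
Proof.
have gG := tdlc_compactly_generated hG.
split; first split.
- by apply/asboolP => x; exact: cvg_cst.
- move=> f g /asboolP cf /asboolP cg; apply/asboolP.
  apply: continuous_from_cg => // K u cK cu.
  by apply: (@continuous_krg_add _ _ N K cK (f \o u) (g \o u));
    exact: continuous_comp_all.
- move=> a f /asboolP cf; apply/asboolP.
  apply: continuous_from_cg => // K u cK cu.
  by apply: (@continuous_krg_scale _ _ N K cK a (f \o u));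
    exact: continuous_comp_all.
Qed.

HB.instance Definition _ := GRing.SubChoice_isSubLmodule.Build R (G -> N)
  (fun f => is_continuous_map f) coinduced continuous_map_closed.

Lemma coinduced_gact_subproof (g : G) (f : coinduced) :
  is_continuous_map (fun x => val f (x * g)%g).
Proof.
have /asboolP cf := valP f; apply/asboolP.
apply: (@continuous_comp_all _ _ _ (fun x => (x * g)%g)) cf.
by apply: mul_continuous => x; [exact: cvg_id|exact: cvg_cst].
Qed.

Definition coinduced_gact (g : G) (f : coinduced) : coinduced :=
  exist (fun h => is_continuous_map h) _ (coinduced_gact_subproof g f).

Lemma coinduced_gact1 f : coinduced_gact 1%g f = f.
Proof. by apply: val_inj; apply/funext => x /=; rewrite mulg1. Qed.

Lemma coinduced_gactM g h f :
  coinduced_gact (g * h)%g f = coinduced_gact g (coinduced_gact h f).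
Proof. by apply: val_inj; apply/funext => x /=; rewrite mulgA. Qed.

Lemma coinduced_gact_linear g : linear (coinduced_gact g).
Proof.
move=> a f h; apply: val_inj; apply/funext => x.
by [].
Qed.

HB.instance Definition _ := Lmodule_isRGModule.Build R G coinduced
  coinduced_gact1 coinduced_gactM coinduced_gact_linear.

(** Admissible means continuous in both variables together; since [G] is locally
    compact, the topology is the k-space refinement of the compact-open one. *)
Definition coinduced_admissible (K : topologicalType) (u : K -> coinduced) :=
  continuous (fun z : K * G => val (u z.1) z.2).

HB.instance Definition _ := Topological.copy coinduced
  (generated_space coinduced_admissible).

Lemma continuous_coinduced (K : topologicalType) (u : K -> coinduced) :
  compact_hausdorff K ->
  continuous (fun z : K * G => val (u z.1) z.2) -> continuous u.
Proof. by move=> cK cu; apply: generated_admissible. Qed.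

(** By the tube lemma, the subbasic sets of the compact-open topology are
    open. *)
Lemma open_coinduced (C : set G) (W : set N) : compact C -> open W ->
  open [set f : coinduced | forall x, C x -> W (val f x)].
Proof.
move=> cC oW; suff : generated_open (adm := coinduced_admissible)
  [set f : coinduced | forall x, C x -> W (val f x)] by [].
move=> K u cK /continuousP cu.
exact: (@open_forall_compact K G C
  ((fun z : K * G => val (u z.1) z.2) @^-1` W) cC (cu W oW)).
Qed.

(** Evaluation is continuous because every point of [G] has arbitrarily small
    compact neighbourhoods. *)
Lemma continuous_coinduced_eval (K : topologicalType) (u : K -> coinduced)
    (g : K -> G) :
  continuous u -> continuous g -> continuous (fun k => val (u k) (g k)).
Proof.
move=> cu cg k U; rewrite nbhsE => -[W [oW Wk] WU].
have [hausG lG dG] := hG.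
have /asboolP cuk := valP (u k).
have [C [cC oC Ck CW]] : exists C : set G,
    [/\ compact C, open C, C (g k) & C `<=` (val (u k)) @^-1` W].
  by apply: compact_open_nbhs => //; apply: cuk; exact: open_nbhs_nbhs.
have n1 : nbhs k (u @^-1` [set f : coinduced | forall x, C x -> W (val f x)]).
  by apply: cu; apply: open_nbhs_nbhs; split; [exact: open_coinduced|exact: CW].
have n2 : nbhs k (g @^-1` C) by apply: cg; exact: open_nbhs_nbhs.
have : nbhs k (u @^-1` [set f : coinduced | forall x, C x -> W (val f x)] `&` g @^-1` C).
  exact: filterI.
by apply: filterS => k' [/= uW /uW ?]; exact: WU.
Qed.

Lemma coinduced_k_space : k_space coinduced.
Proof.
apply: generated_k_space => f f' ff'; apply: val_inj; apply/funext => x.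
apply: (ff' N (fun f : coinduced => val f x)); first exact: krg_k_space.
apply: (@continuous_coinduced_eval coinduced id (fun=> x)).
  exact: id_continuous_all.
exact: cst_continuous.
Qed.

Lemma continuous_coinducedP (K : topologicalType) (u : K -> coinduced) :
  compact_hausdorff K ->
  (forall (L : topologicalType) (k : L -> K) (g : L -> G), compact_hausdorff L ->
     continuous k -> continuous g -> continuous (fun l => val (u (k l)) (g l))) ->
  continuous u.
Proof.
move=> cK cu; apply: continuous_coinduced => //.
apply: continuous_from_cg => [|L v cL cv].
  exact: compact_times_tdlc_compactly_generated.
apply: (cu L (fun l => (v l).1) (fun l => (v l).2)) => //.
  exact: continuous_comp_fst.
exact: continuous_comp_snd.
Qed.

Lemma coinduced_add_continuous :
  continuous (fun z : kify (coinduced * coinduced)%type => z.1 + z.2 : coinduced).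
Proof.
apply/kify_continuousP => K u cK cu; apply: continuous_coinducedP => // L k g cL ck cg.
rewrite (_ : (fun l => _) =
  fun l => val (u (k l)).1 (g l) + val (u (k l)).2 (g l)); last first.
  by apply/funext.
have cuk : continuous (fun l => u (k l)) by exact: continuous_comp_all ck cu.
apply: continuous_krg_add => //; apply: continuous_coinduced_eval => //.
  exact: (@continuous_comp_fst _ _ _ (fun l => u (k l))).
exact: (@continuous_comp_snd _ _ _ (fun l => u (k l))).
Qed.

Lemma coinduced_scale_continuous :
  continuous (fun z : kify (discrete_topology R * coinduced)%type =>
    (z.1 : R) *: (z.2 : coinduced)).
Proof.
apply/kify_continuousP => K u cK cu; apply: continuous_coinducedP => // L k g cL ck cg.
rewrite (_ : (fun l => _) =
  fun l => ((u (k l)).1 : R) *: val (u (k l)).2 (g l)); last first.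
  by apply/funext.
have cuk : continuous (fun l => u (k l)) by exact: continuous_comp_all ck cu.
apply: continuous_krg_scale2 => //.
  exact: (@continuous_comp_fst _ _ _ (fun l => u (k l))).
apply: continuous_coinduced_eval => //.
exact: (@continuous_comp_snd _ _ _ (fun l => u (k l))).
Qed.

Lemma coinduced_act_continuous :
  continuous (fun z : kify (G * coinduced)%type => gact z.1 z.2 : coinduced).
Proof.
apply/kify_continuousP => K u cK cu; apply: continuous_coinducedP => // L k g cL ck cg.
rewrite (_ : (fun l => _) =
  fun l => val (u (k l)).2 (g l * (u (k l)).1)%g); last by apply/funext.
have cuk : continuous (fun l => u (k l)) by exact: continuous_comp_all ck cu.
apply: continuous_coinduced_eval => //.
  exact: (@continuous_comp_snd _ _ _ (fun l => u (k l))).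
apply: mul_continuous => //.
exact: (@continuous_comp_fst _ _ _ (fun l => u (k l))).
Qed.

HB.instance Definition _ := RGModule_isKRGModule.Build R G coinduced
  coinduced_k_space coinduced_add_continuous coinduced_scale_continuous
  coinduced_act_continuous.

End coinduced.

(** A map [h] of two variables is the same as a map from [Y] to the coinduced
    module.  The equivariant extension of the latter, evaluated at [1], is
    linear and continuous but need not respect the action. *)
Lemma free_linear_extension (R : comPzRingType) (G : topGroupType)
    (I : choiceType) (Y : I -> topologicalType) (N : kRGModType R G)
    (h : G -> {i & Y i} -> N) :
  tdlc G -> (forall i, compact_hausdorff (Y i)) ->
  (forall i, continuous (fun z : Y i * G => h z.2 (existT _ i z.1))) ->
  exists s : free_module R G {i & Y i} -> N,
    [/\ linear s, continuous s & forall g y, s (gact g (free_eta R G y)) = h g y].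
Proof.
move=> hG cY ch.
have hc y : is_continuous_map (fun g => h g y).
  case: y => i y; apply/asboolP.
  apply: (@continuous_comp_all _ _ _ (fun g : G => (y, g)) _ _ (ch i)).
  by apply: continuous_pair => x; [exact: cvg_cst|exact: cvg_id].
pose H y : coinduced hG N := exist (fun f => is_continuous_map f) _ (hc y).
have cH : continuous H.
  apply/continuousP => U oU; apply/sigT_openP => i.
  rewrite -comp_preimage.
  have /continuousP : continuous (H \o existT _ i).
    by apply: continuous_coinduced => //; exact: ch.
  exact.
exists (fun x => val (free_lift cH x) 1%g); split.
- by move=> a x y; rewrite khomD khomZ.
- apply: (@continuous_coinduced_eval _ _ hG N _ (free_lift cH) (fun=> 1%g)).
    exact: khom_continuous.
  exact: cst_continuous.
- by move=> g y; rewrite khomG /= free_ev_eta //= mul1g.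
Qed.

(** * Products of two modules *)

Section product_module.
Context (R : comPzRingType) (G : topGroupType) (A B : kRGModType R G).

Definition prod_module : Type := (A * B)%type.

HB.instance Definition _ := GRing.Lmodule.copy prod_module (A * B)%type.
HB.instance Definition _ := Topological.copy prod_module
  (generated_space (fun (K : topologicalType) (u : K -> (A * B)%type) => continuous u)).

Definition prod_gact (g : G) (x : prod_module) : prod_module :=
  (gact g x.1, gact g x.2).

Lemma prod_gact1 x : prod_gact 1%g x = x.
Proof. by case: x => x y; rewrite /prod_gact /= !gact1. Qed.

Lemma prod_gactM g h x : prod_gact (g * h)%g x = prod_gact g (prod_gact h x).
Proof. by rewrite /prod_gact /= !gactM. Qed.

Lemma prod_gact_linear g : linear (prod_gact g).
Proof. by move=> a [x y] [z t]; rewrite /prod_gact /= !gact_linear. Qed.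

HB.instance Definition _ := Lmodule_isRGModule.Build R G prod_module
  prod_gact1 prod_gactM prod_gact_linear.

Lemma prod_fst_continuous : continuous (fun x : prod_module => x.1).
Proof. by apply: generated_continuous => K u cK cu; exact: continuous_comp_fst. Qed.

Lemma prod_snd_continuous : continuous (fun x : prod_module => x.2).
Proof. by apply: generated_continuous => K u cK cu; exact: continuous_comp_snd. Qed.

Lemma continuous_prod_module (K : topologicalType) (u : K -> prod_module) :
  compact_hausdorff K -> continuous (fun k => (u k).1) ->
  continuous (fun k => (u k).2) -> continuous u.
Proof.
move=> cK c1 c2; apply: generated_admissible => //.
rewrite (_ : u = fun k => ((u k).1, (u k).2)); first exact: continuous_pair.
by apply/funext => k; case: (u k).
Qed.

Lemma prod_k_space : k_space prod_module.
Proof.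
apply: generated_k_space => -[x1 x2] [y1 y2] xy; congr pair.
  by apply: (xy A _ _ prod_fst_continuous); exact: krg_k_space.
by apply: (xy B _ _ prod_snd_continuous); exact: krg_k_space.
Qed.

Section coordinates.
Context (X : topologicalType) (u : X -> prod_module) (cu : continuous u).

Lemma continuous_prod1 : continuous (fun x => (u x).1).
Proof. exact: continuous_comp_all cu prod_fst_continuous. Qed.

Lemma continuous_prod2 : continuous (fun x => (u x).2).
Proof. exact: continuous_comp_all cu prod_snd_continuous. Qed.

End coordinates.

Lemma prod_add_continuous :
  continuous (fun z : kify (prod_module * prod_module)%type => z.1 + z.2 : prod_module).
Proof.
apply/kify_continuousP => K u cK cu.
have c1 : continuous (fun k => (u k).1) by exact: continuous_comp_fst.
have c2 : continuous (fun k => (u k).2) by exact: continuous_comp_snd.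
apply: continuous_prod_module => //.
  apply: (@continuous_krg_add _ _ A K cK (fun k => (u k).1.1) (fun k => (u k).2.1)).
    exact: (continuous_prod1 c1).
  exact: (continuous_prod1 c2).
apply: (@continuous_krg_add _ _ B K cK (fun k => (u k).1.2) (fun k => (u k).2.2)).
  exact: (continuous_prod2 c1).
exact: (continuous_prod2 c2).
Qed.

Lemma prod_scale_continuous :
  continuous (fun z : kify (discrete_topology R * prod_module)%type =>
    (z.1 : R) *: (z.2 : prod_module)).
Proof.
apply/kify_continuousP => K u cK cu.
have c1 : continuous (fun k => (u k).1) by exact: continuous_comp_fst.
have c2 : continuous (fun k => (u k).2) by exact: continuous_comp_snd.
apply: continuous_prod_module => //.
  apply: (@continuous_krg_scale2 _ _ A K cK _ (fun k => (u k).2.1)) => //.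
  exact: (continuous_prod1 c2).
apply: (@continuous_krg_scale2 _ _ B K cK _ (fun k => (u k).2.2)) => //.
exact: (continuous_prod2 c2).
Qed.

Lemma prod_act_continuous :
  continuous (fun z : kify (G * prod_module)%type => gact z.1 z.2 : prod_module).
Proof.
apply/kify_continuousP => K u cK cu.
have c1 : continuous (fun k => (u k).1) by exact: continuous_comp_fst.
have c2 : continuous (fun k => (u k).2) by exact: continuous_comp_snd.
apply: continuous_prod_module => //.
  apply: (@continuous_krg_act _ _ A K cK _ (fun k => (u k).2.1)) => //.
  exact: (continuous_prod1 c2).
apply: (@continuous_krg_act _ _ B K cK _ (fun k => (u k).2.2)) => //.
exact: (continuous_prod2 c2).
Qed.

HB.instance Definition _ := RGModule_isKRGModule.Build R G prod_module
  prod_k_space prod_add_continuous prod_scale_continuous prod_act_continuous.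

Lemma prod_fst_morphism : rg_morphism (fun x : prod_module => x.1).
Proof. by split. Qed.

Lemma prod_snd_morphism : rg_morphism (fun x : prod_module => x.2).
Proof. by split. Qed.

Definition prod_fst : khom prod_module A := KHom prod_fst_morphism prod_fst_continuous.
Definition prod_snd : khom prod_module B := KHom prod_snd_morphism prod_snd_continuous.

Section pairing.
Context (C : kRGModType R G) (f : khom C A) (g : khom C B).

Lemma prod_pair_morphism : rg_morphism (fun x => (f x, g x) : prod_module).
Proof. by split=> [a x y|k x]; rewrite ?khomD ?khomZ ?khomG. Qed.

Lemma prod_pair_continuous : continuous (fun x => (f x, g x) : prod_module).
Proof.
apply: continuous_from_cg => [|K u cK cu]; first by case: (@krg_k_space R G C).
by apply: continuous_prod_module => //;
  apply: (continuous_comp_all cu); exact: khom_continuous.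
Qed.

Definition prod_pair : khom C prod_module := KHom prod_pair_morphism prod_pair_continuous.
End pairing.

Definition prod_inl := prod_pair (khom_id A) (khom_zero A B).
Definition prod_inr := prod_pair (khom_zero B A) (khom_id B).

Definition prod_copair (C : kRGModType R G) (f : khom A C) (g : khom B C) :
  khom prod_module C := khom_add (khom_comp f prod_fst) (khom_comp g prod_snd).

Lemma prod_copairE (C : kRGModType R G) (f : khom A C) (g : khom B C) x :
  prod_copair f g x = f x.1 + g x.2.
Proof. exact: khom_addE. Qed.

Lemma prod_inE (x : prod_module) : x = prod_inl x.1 + prod_inr x.2.
Proof.
by case: x => x y; congr pair; rewrite /= ?addr0 ?add0r.
Qed.

End product_module.

Arguments prod_fst {R G} A B.
Arguments prod_snd {R G} A B.
Arguments prod_inl {R G} A B.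
Arguments prod_inr {R G} A B.

(** * Kernels, CH-split maps and projectives *)

Section kernels.
Context (R : comPzRingType) (G : topGroupType).
Implicit Types A B C X E Z P Q W D F N : kRGModType R G.

(** [i] is a kernel of [p] up to isomorphism of topological modules.  Since the
    modules are k-spaces, testing continuity on compact Hausdorff spaces
    determines the topology of [X]. *)
Definition is_kernel X E Z (i : khom X E) (p : khom E Z) : Prop :=
  [/\ injective i, forall e, p e = 0 <-> exists x, i x = e &
      forall (K : topologicalType) (u : K -> X), compact_hausdorff K ->
        continuous (i \o u) -> continuous u].

Lemma kernel_val_morphism A B (f : khom A B) :
  rg_morphism (fun x : kernel f => val x).
Proof. by split. Qed.

Definition kernel_incl A B (f : khom A B) : khom (kernel f) A :=
  KHom (kernel_val_morphism f) (@set_val_continuous _ _).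

Lemma kernel_mem A B (f : khom A B) (x : kernel f) : f (val x) = 0.
Proof. exact: set_mem (valP x). Qed.

Lemma kernel_is_kernel A B (f : khom A B) : is_kernel (kernel_incl f) f.
Proof.
split; first exact: val_inj.
  move=> e; split=> [fe|[x <-]]; last exact: kernel_mem.
  by exists (exist _ e (mem_set fe)).
by move=> K u _; exact: set_type_continuous.
Qed.

Lemma is_kernel_comp0 X E Z (i : khom X E) (p : khom E Z) x :
  is_kernel i p -> p (i x) = 0.
Proof. by move=> [_ pE _]; apply/pE; exists x. Qed.

Lemma kernel_factor X E Z (i : khom X E) (p : khom E Z) A (f : khom A E) :
  is_kernel i p -> (forall a, p (f a) = 0) ->
  exists g : khom A X, forall a, i (g a) = f a.
Proof.
move=> [iI pE ci] pf.
have /choice [g ig] : forall a, exists x, i x = f a by move=> a; exact/pE.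
have gM : rg_morphism g.
  split=> [a x y|k x]; apply: iI; first by rewrite khomD khomZ !ig khomD khomZ.
  by rewrite khomG !ig khomG.
have gC : continuous g.
  apply: continuous_from_cg => [|K u cK cu]; first by case: (@krg_k_space R G A).
  apply: ci => //; rewrite (_ : i \o (g \o u) = f \o u).
    apply: continuous_comp_all cu _; exact: khom_continuous.
  by apply/funext => k /=.
by exists (KHom gM gC).
Qed.

Lemma CH_split_comp A B C (f : khom B C) (g : khom A B) :
  CH_split f -> CH_split g -> CH_split (khom_comp f g).
Proof.
move=> sf sg P pP h; have [k fk] := sf P pP h; have [l gl] := sg P pP k.
by exists l => x; rewrite /= gl fk.
Qed.

Lemma CH_split_retract A B (f : khom A B) (s : khom B A) :
  (forall b, f (s b) = b) -> CH_split f.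
Proof. by move=> fs P pP h; exists (khom_comp s h) => x /=. Qed.

Lemma direct_summand_retract P F (i : khom P F) (p : khom F P) :
  (forall x, p (i x) = x) -> direct_summand P F.
Proof.
move=> pi; have kerp := kernel_is_kernel p.
have [|q qE] := kernel_factor (f := khom_sub (khom_id F) (khom_comp i p)) kerp.
  by move=> a; rewrite khom_subE khomB /= pi subrr.
exists (kernel p), i, p, (kernel_incl p), q; split=> //.
- move=> x; apply: val_inj; rewrite -[LHS]/(kernel_incl p _) qE khom_subE /=.
  by rewrite kernel_mem khom0 subr0.
- move=> x; apply: val_inj; rewrite -[LHS]/(kernel_incl p _) qE khom_subE /=.
  by rewrite pi subrr.
- exact: kernel_mem.
- by move=> y; rewrite qE khom_subE /= addrC subrK.
Qed.

Lemma projective_free (I : choiceType) (K : I -> topologicalType) F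
    (eta : {i & K i} -> F) :
  (forall i, compact_hausdorff (K i)) -> free_on eta -> projective F.
Proof.
move=> cK fF; exists I, K, F, eta; split=> //.
exact: (@direct_summand_retract F F (khom_id F) (khom_id F)).
Qed.

Lemma free_khom_eq (Y : topologicalType) F (eta : Y -> F) N (f g : khom F N) :
  free_on eta -> (forall y, f (eta y) = g (eta y)) -> f =1 g.
Proof.
move=> [ceta uF] fg x.
have [|phi [_ uphi]] := uF N (g \o eta).
  by apply: continuous_comp_all ceta _; exact: khom_continuous.
by rewrite (uphi f fg) (uphi g _).
Qed.

(** The section [s] need not be linear: a lift of [g] is prescribed on the
    generators of a free module, and [s] supplies their images
    continuously. *)
Lemma CH_split_section A B (f : khom A B) (s : B -> A) :
  continuous s -> (forall b, f (s b) = b) -> CH_split f.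
Proof.
move=> cs fs P [I [K [F [eta [cK fF [Q [iP [pP [_ [_ [pi _ _ _ _]]]]]]]]]]] g.
have [ceta uF] := fF.
have [|phi [phiE _]] := uF A (fun y => s (g (pP (eta y)))).
  apply: (continuous_comp_all _ cs).
  apply: (@continuous_comp_all _ _ _ (fun y => pP (eta y))).
    by apply: (continuous_comp_all ceta); exact: khom_continuous.
  exact: khom_continuous.
exists (khom_comp phi iP) => x /=.
have e := free_khom_eq (f := khom_comp f phi) (g := khom_comp g pP) fF.
by rewrite -[LHS]/(khom_comp f phi (iP x)) e /= ?pi // => y; rewrite /= phiE fs.
Qed.

Definition free_point : kRGModType R G :=
  free_module R G {i : unit & discrete_topology unit}.

Lemma free_point_compact : compact_hausdorff {i : unit & discrete_topology unit}.
Proof.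
apply: compact_hausdorff_sum => [|_]; first exact: finite_finset.
exact: unit_compact_hausdorff.
Qed.

Lemma free_point_free :
  free_on (@free_eta R G {i : unit & discrete_topology unit}).
Proof.
apply: free_module_free; apply: compact_hausdorff_compactly_generated.
exact: free_point_compact.
Qed.

(** Lift the map from the free module on a point which hits [b]. *)
Lemma CH_split_surjective A B (f : khom A B) b : CH_split f -> exists a, f a = b.
Proof.
move=> /(_ free_point) sf.
have pF : projective free_point.
  by apply: (projective_free _ free_point_free) => _; exact: unit_compact_hausdorff.
have cb : continuous (fun _ : {i : unit & discrete_topology unit} => b).
  exact: cst_continuous.
have [h hE] := sf pF (free_lift cb).
pose y : {i : unit & discrete_topology unit} := existT _ tt tt.
by exists (h (free_eta R G y)); rewrite hE /= free_ev_eta.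
Qed.

(** The product of two modules is also their sum, so it is free on the disjoint
    union [Y] of the two spaces of generators. *)
Lemma free_on_prod (Y1 Y2 Y : topologicalType) F1 F2 (eta1 : Y1 -> F1)
    (eta2 : Y2 -> F2) (j1 : Y1 -> Y) (j2 : Y2 -> Y) (eta : Y -> prod_module F1 F2) :
  free_on eta1 -> free_on eta2 -> continuous j1 -> continuous j2 ->
  (forall y, (exists y1, y = j1 y1) \/ (exists y2, y = j2 y2)) ->
  continuous eta -> (forall y, eta (j1 y) = prod_inl F1 F2 (eta1 y)) ->
  (forall y, eta (j2 y) = prod_inr F1 F2 (eta2 y)) -> free_on eta.
Proof.
move=> f1 f2 c1 c2 jj ceta e1 e2; split=> // N h ch.
have [phi1 [phi1E _]] := f1.2 N (h \o j1) (continuous_comp_all c1 ch).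
have [phi2 [phi2E _]] := f2.2 N (h \o j2) (continuous_comp_all c2 ch).
exists (prod_copair phi1 phi2); split=> [y|psi psiE x].
  rewrite prod_copairE; case: (jj y) => -[z ->].
    by rewrite e1 /= phi1E khom0 addr0.
  by rewrite e2 /= phi2E khom0 add0r.
rewrite prod_copairE [x in psi x]prod_inE khomD; congr (_ + _).
  rewrite -[LHS]/(khom_comp psi (prod_inl F1 F2) _).
  apply: free_khom_eq f1 _ _ => y.
  by rewrite /= -[(_, _)]/(prod_inl F1 F2 _) -e1 psiE phi1E.
rewrite -[LHS]/(khom_comp psi (prod_inr F1 F2) _).
apply: free_khom_eq f2 _ _ => y.
by rewrite /= -[(_, _)]/(prod_inr F1 F2 _) -e2 psiE phi2E.
Qed.

Definition prod_map A B A' B' (f : khom A A') (g : khom B B') :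
  khom (prod_module A B) (prod_module A' B') :=
  prod_pair (khom_comp f (prod_fst A B)) (khom_comp g (prod_snd A B)).

Definition sum_family (I J : Type) (T : Type) (K : I -> T) (L : J -> T) (s : I + J) : T :=
  match s with inl i => K i | inr j => L j end.

Lemma projective_prod P Q : projective P -> projective Q -> projective (prod_module P Q).
Proof.
move=> [I [K [F1 [eta1 [cK f1 [Q1 [i1 [p1 [_ [_ [pi1 _ _ _ _]]]]]]]]]]].
move=> [J [L [F2 [eta2 [cL f2 [Q2 [i2 [p2 [_ [_ [pi2 _ _ _ _]]]]]]]]]]].
pose j1 : {i & K i} -> {s & sum_family K L s} :=
  fun y => existT (sum_family K L) (inl (projT1 y)) (projT2 y).
pose j2 : {i & L i} -> {s & sum_family K L s} :=
  fun y => existT (sum_family K L) (inr (projT1 y)) (projT2 y).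
pose eta : {s & sum_family K L s} -> prod_module F1 F2 := fun y =>
  match y with
  | existT (inl i) k => prod_inl F1 F2 (eta1 (existT K i k))
  | existT (inr i) k => prod_inr F1 F2 (eta2 (existT L i k))
  end.
exists (I + J)%type, (sum_family K L), (prod_module F1 F2), eta; split.
- by case.
- apply: (free_on_prod (j1 := j1) (j2 := j2) f1 f2) => //.
  + move=> [i k] U nU; exact: (@existT_continuous _ (sum_family K L) (inl i) k U nU).
  + move=> [i k] U nU; exact: (@existT_continuous _ (sum_family K L) (inr i) k U nU).
  + by move=> [[i|j] k]; [left; exists (existT K i k)|right; exists (existT L j k)].
  + move=> [[i|j] k] U nU.
      suff : continuous (fun k => prod_inl F1 F2 (eta1 (existT K i k))) by apply.
      apply: (@continuous_comp_all _ _ _ (fun k => eta1 (existT K i k))).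
        exact: continuous_comp_all (@existT_continuous _ _ i) f1.1.
      exact: khom_continuous.
    suff : continuous (fun k => prod_inr F1 F2 (eta2 (existT L j k))) by apply.
    apply: (@continuous_comp_all _ _ _ (fun k => eta2 (existT L j k))).
      exact: continuous_comp_all (@existT_continuous _ _ j) f2.1.
    exact: khom_continuous.
  + by case.
  + by case.
- apply: (@direct_summand_retract _ _ (prod_map i1 i2) (prod_map p1 p2)).
  by move=> [x y]; rewrite /= pi1 pi2.
Qed.

Lemma CH_split_prod A B A' B' (f : khom A A') (g : khom B B') :
  CH_split f -> CH_split g -> CH_split (prod_map f g).
Proof.
move=> sf sg P pP h.
have [h1 h1E] := sf P pP (khom_comp (prod_fst _ _) h).
have [h2 h2E] := sg P pP (khom_comp (prod_snd _ _) h).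
exists (prod_pair h1 h2) => x; rewrite /= h1E h2E /=.
by case: (h x).
Qed.

Lemma compactly_generated_prod P Q :
  compactly_generated P -> compactly_generated Q ->
  compactly_generated (prod_module P Q).
Proof.
move=> [K [F1 [eta1 [f [cK f1 sf]]]]] [L [F2 [eta2 [g [cL f2 sg]]]]].
pose T (b : bool) := if b then K else L.
pose eta (y : {b & T b}) : prod_module F1 F2 :=
  match y with
  | existT true k => prod_inl F1 F2 (eta1 k)
  | existT false k => prod_inr F1 F2 (eta2 k)
  end.
exists {b & T b}, (prod_module F1 F2), eta, (prod_map f g); split.
- by apply: compact_hausdorff_sum => [|[]] //; exact: finite_finset.
- apply: (free_on_prod (j1 := existT T true) (j2 := existT T false) f1 f2) => //.
  + exact: existT_continuous.
  + exact: existT_continuous.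
  + by move=> [[] k]; [left|right]; exists k.
  + move=> [[] k] U nU.
      suff : continuous (fun k => prod_inl F1 F2 (eta1 k)) by apply.
      by apply: (continuous_comp_all f1.1); exact: khom_continuous.
    suff : continuous (fun k => prod_inr F1 F2 (eta2 k)) by apply.
    by apply: (continuous_comp_all f2.1); exact: khom_continuous.
- exact: CH_split_prod.
Qed.

Lemma projective_zero A : (forall x : A, x = 0) -> projective A.
Proof.
move=> A0; exists unit, (fun=> discrete_topology unit), free_point, (@free_eta R G _).
split; [by move=> _; exact: unit_compact_hausdorff|exact: free_point_free|].
apply: (@direct_summand_retract _ _ (khom_zero _ _) (khom_zero _ _)) => x.
exact/esym/A0.
Qed.

Lemma compactly_generated_zero A : (forall x : A, x = 0) -> compactly_generated A.
Proof.
move=> A0; exists {i : unit & discrete_topology unit}, free_point, (@free_eta R G _).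
exists (khom_zero _ _); split; [exact: free_point_compact|exact: free_point_free|].
by apply: (@CH_split_retract _ _ _ (khom_zero _ _)) => b; exact/esym/A0.
Qed.

End kernels.

(** * Resolutions and their finiteness ranks *)

Section KP.
Context (R : comPzRingType) (G : topGroupType).
Implicit Types A B C X E Z P Q W D F N : kRGModType R G.
Implicit Types m : option nat.

Definition natinf_pred m : option nat := omap predn m.
Definition natinf_succ m : option nat := omap S m.

(** A rank [m] counts the terms, from degree [0] on, that are required to be
    finite in the sense of [good]; [None] is infinity.  So [FP_n] and [KP_n]
    correspond to rank [n + 1], and passing to a kernel lowers the rank by
    one. *)
Definition resolution_step (good : option nat -> kRGModType R G -> Prop)
    (epi : forall P A, khom P A -> Prop)
    (S : option nat -> kRGModType R G -> Prop) m A : Prop :=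
  exists P X (i : khom X P) (p : khom P A),
    [/\ good m P, epi _ _ p, is_kernel i p & S (natinf_pred m) X].

(** The greatest predicate stable under [resolution_step].  Resolutions are
    handled one short exact sequence at a time: to build one it suffices to give
    an invariant [S] of the successive kernels. *)
Definition resolvable (good : option nat -> kRGModType R G -> Prop)
    (epi : forall P A, khom P A -> Prop) m A : Prop :=
  exists S, (forall m A, S m A -> resolution_step good epi S m A) /\ S m A.

Lemma resolvable_unfold good epi m A :
  resolvable good epi m A -> resolution_step good epi (resolvable good epi) m A.
Proof.
move=> [S [Sstep SA]]; have [P [X [i [p [? ? ? SX]]]]] := Sstep _ _ SA.
by exists P, X, i, p; split=> //; exists S.
Qed.

Definition KP_good m P : Prop :=
  projective P /\ (m <> Some 0%N -> compactly_generated P).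

Definition KP : option nat -> kRGModType R G -> Prop :=
  resolvable KP_good (@CH_split R G).

Lemma exists_kernel A B (f : khom A B) :
  exists X (i : khom X A), is_kernel i f.
Proof. by exists (kernel f), (kernel_incl f); exact: kernel_is_kernel. Qed.

Lemma is_kernel_inj X E Z (i : khom X E) (p : khom E Z) :
  is_kernel i p -> injective i.
Proof. by case. Qed.

(** The kernel [N] of [r] after [q] is the preimage under [q] of the kernel [W]
    of [r], hence an extension of [W] by the kernel of [q]. *)
Lemma kernel_of_composite D X Q W K' (q : khom Q D) (k : khom K' Q)
    (r : khom D X) (w : khom W D) :
  CH_split q -> is_kernel k q -> is_kernel w r ->
  exists N (n : khom N Q) (t : khom N W) (k' : khom K' N),
    [/\ is_kernel n (khom_comp r q), CH_split t & is_kernel k' t].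
Proof.
move=> sq kk kw; have [N [n kn]] := exists_kernel (khom_comp r q).
have rqn x : r (q (n x)) = 0 := is_kernel_comp0 x kn.
have [t tE] := kernel_factor (f := khom_comp q n) kw rqn.
have [|k' k'E] := kernel_factor (f := k) kn.
  by move=> a; rewrite /= (is_kernel_comp0 a kk) khom0.
have [nI nE nC] := kn; have [kI kE kC] := kk; have [wI wE wC] := kw.
exists N, n, t, k'; split=> //.
  move=> P pP f; have [h hE] := sq P pP (khom_comp w f).
  have [|g gE] := kernel_factor (f := h) kn.
    by move=> a; rewrite /= hE /= (is_kernel_comp0 _ kw).
  by exists g => x; apply: wI; rewrite tE /= gE hE.
split.
- by move=> x y xy; apply: kI; rewrite -!k'E xy.
- move=> e; split=> [te|[x <-]].
    have /kE [x xe] : q (n e) = 0 by have := tE e; rewrite te khom0.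
    by exists x; apply: nI; rewrite k'E.
  by apply: wI; rewrite tE /= k'E (is_kernel_comp0 _ kk) khom0.
- move=> K u cK cu; apply: kC => //.
  rewrite (_ : k \o u = n \o (k' \o u)).
    by apply: (continuous_comp_all cu); exact: khom_continuous.
  by apply/funext => y /=; rewrite k'E.
Qed.

(** Lift [b] along [p] to a map [b'] and cover [E] by the sum of [i a] and [b'].
    For a map [f] into the kernel of [b], the map [b' iZ f] takes values in the
    image of [i], hence lifts to [PX]; this shows that the map [q] from the new
    kernel to the kernel of [b] is CH-split. *)
Lemma horseshoe X E Z (i : khom X E) (p : khom E Z) PX KX (a : khom PX X)
    (iX : khom KX PX) PZ KZ (b : khom PZ Z) (iZ : khom KZ PZ) :
  is_kernel i p -> CH_split p -> projective PZ ->
  CH_split a -> is_kernel iX a -> CH_split b -> is_kernel iZ b ->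
  exists N (c : khom (prod_module PX PZ) E) (n : khom N (prod_module PX PZ))
      (k : khom KX N) (q : khom N KZ),
    [/\ CH_split c, is_kernel n c, is_kernel k q & CH_split q].
Proof.
move=> ki sp pZ sa kX sb kZ.
have [b' b'E] := sp PZ pZ b.
pose c := prod_copair (khom_comp i a) b'.
have cE x : c x = i (a x.1) + b' x.2 by exact: prod_copairE.
have [N [n kn]] := exists_kernel c.
have cn x : c (n x) = 0 := is_kernel_comp0 x kn.
have [iI iE iC] := ki; have [nI nE nC] := kn.
have [aI aE aC] := kX; have [bI bE bC] := kZ.
have bn x : b (n x).2 = 0.
  rewrite -b'E; have := congr1 p (cn x).
  by rewrite cE khomD khom0 (is_kernel_comp0 _ ki) add0r.
have [q qE] := kernel_factor (f := khom_comp (prod_snd PX PZ) n) kZ bn.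
have [|k kE] := kernel_factor (f := khom_comp (prod_inl PX PZ) iX) kn.
  by move=> x; rewrite cE /= (is_kernel_comp0 _ kX) !khom0 addr0.
exists N, c, n, k, q; split=> //.
- move=> P pP f.
  have [g gE] := sb P pP (khom_comp p f).
  have [|f' f'E] := kernel_factor (f := khom_sub f (khom_comp b' g)) ki.
    by move=> x; rewrite khom_subE khomB /= b'E gE subrr.
  have [g' g'E] := sa P pP f'.
  exists (prod_pair g' g) => x.
  by rewrite cE /= g'E f'E khom_subE /= subrK.
- split.
  + move=> x y xy; apply: aI; have := congr1 n xy; rewrite !kE /= => e.
    exact: (congr1 fst e).
  + move=> e; split=> [qe|[x <-]].
      have e2 : (n e).2 = 0 by have := qE e; rewrite qe khom0.
      have : a (n e).1 = 0.
        by apply: iI; have := cn e; rewrite cE e2 !khom0 addr0.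
      move=> /aE [x xe]; exists x; apply: nI; rewrite kE /= xe -e2.
      by case: (n e).
    by apply: bI; rewrite qE /= khom0; have := kE x; rewrite /= => ->.
  + move=> K u cK cu; apply: aC => //.
    rewrite (_ : iX \o u = prod_fst PX PZ \o (n \o (k \o u))).
      apply: continuous_comp_all (@khom_continuous _ _ _ _ (prod_fst PX PZ)).
      by apply: (continuous_comp_all cu); exact: khom_continuous.
    by apply/funext => y /=; have := kE (u y); rewrite /= => ->.
- move=> P pP f.
  have [|f' f'E] := kernel_factor (f := khom_comp b' (khom_comp iZ f)) ki.
    by move=> x; rewrite /= b'E (is_kernel_comp0 _ kZ).
  have [h hE] := sa P pP f'.
  have [|g gE] := kernel_factor
      (f := prod_pair (khom_sub (khom_zero _ _) h) (khom_comp iZ f)) kn.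
    by move=> x; rewrite cE /= scaler0 add0r scaleN1r !khomN hE f'E /= addNr.
  by exists g => x; apply: bI; rewrite qE /= gE.
Qed.

(** The kernels in the horseshoe lemma are again such an extension, of lower
    rank. *)
Lemma KP_extension m X E Z (i : khom X E) (p : khom E Z) :
  is_kernel i p -> CH_split p -> KP m X -> KP m Z -> KP m E.
Proof.
move=> ki sp kX kZ.
exists (fun m E => exists X Z (i : khom X E) (p : khom E Z),
  [/\ is_kernel i p, CH_split p, KP m X & KP m Z]); split; last by exists X, Z, i, p.
move=> {ki sp kX kZ} {}m {}E [{}X [{}Z [{}i [{}p [ki sp]]]]].
move=> /resolvable_unfold [PX [KX [iX [a [[pPX gPX] sa kiX KKX]]]]].
move=> /resolvable_unfold [PZ [KZ [iZ [b [[pPZ gPZ] sb kiZ KKZ]]]]].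
have [N [c [n [k [q [sc kn kk sq]]]]]] := horseshoe ki sp pPZ sa kiX sb kiZ.
exists (prod_module PX PZ), N, n, c; split=> //; last by exists KX, KZ, k, q.
split; first exact: projective_prod.
by move=> m0; apply: compactly_generated_prod; [exact: gPX|exact: gPZ].
Qed.

(** Cover [X] by the cover of [D]: the kernel is an extension of [W] by the
    kernel of the latter. *)
Lemma KP_quotient m W D X (w : khom W D) (r : khom D X) :
  is_kernel w r -> CH_split r -> KP m D -> KP (natinf_pred m) W -> KP m X.
Proof.
move=> kw sr /resolvable_unfold [Q [K' [k [q [gQ sq kk kK']]]]] kW.
have [N [n [t [k' [kn st kk']]]]] := kernel_of_composite sq kk kw.
exists (fun m' X' => (m' = m /\ X' = X) \/ KP m' X'); split; last by left.
move=> m' X' [[-> ->]|kX'].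
  exists Q, N, n, (khom_comp r q); split=> //; first exact: CH_split_comp.
  by right; exact: KP_extension kk' st kK' kW.
have [P [X'' [i [p [? ? ? ?]]]]] := resolvable_unfold kX'.
by exists P, X'', i, p; split=> //; right.
Qed.

Lemma kernel_id_zero A (x : kernel (khom_id A)) : x = 0.
Proof.
apply: (is_kernel_inj (kernel_is_kernel _)); rewrite khom0.
exact: (kernel_mem x).
Qed.

(** Resolve [P] by itself; the invariant also holds for the zero kernel. *)
Lemma KP_projective m P :
  projective P -> (m <> Some 0%N -> compactly_generated P) -> KP m P.
Proof.
move=> pP gP.
exists KP_good; split=> //.
move=> {pP gP} {}m {}P [pP gP].
exists P, (kernel (khom_id P)), (kernel_incl _), (khom_id P).
split=> //.
- exact: (@CH_split_retract _ _ _ _ (khom_id P) (khom_id P)).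
- exact: kernel_is_kernel.
- split=> [|_]; first by apply: projective_zero; exact: kernel_id_zero.
  by apply: compactly_generated_zero; exact: kernel_id_zero.
Qed.

(** Form the pullback [D] of [p] and a projective cover [b] of [Z].  It is an
    extension of [E] by the kernel of [b], and also the sum of [X] and the
    projective [P]; so [X] is a quotient of [D] with kernel [P]. *)
Lemma KP_kernel m X E Z (i : khom X E) (p : khom E Z) :
  is_kernel i p -> CH_split p -> KP (natinf_pred m) E -> KP m Z ->
  KP (natinf_pred m) X.
Proof.
move=> ki sp kE /resolvable_unfold [P [K [k [b [[pP gP] sb kk kK]]]]].
pose f := khom_sub (khom_comp p (prod_fst E P)) (khom_comp b (prod_snd E P)).
have fE x : f x = p x.1 - b x.2 by rewrite khom_subE.
have [D [d kd]] := exists_kernel f.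
have [dI dE dC] := kd; have [iI iE iC] := ki; have [kI kkE kC] := kk.
have fd x : p (d x).1 = b (d x).2.
  by apply/eqP; rewrite -subr_eq0 -fE; apply/eqP; exact: is_kernel_comp0.
have [b' b'E] := sp P pP b.
have kD : KP (natinf_pred m) D.
  have [|j jE] := kernel_factor (f := khom_comp (prod_inr E P) k) kd.
    by move=> x; rewrite fE /= khom0 (is_kernel_comp0 _ kk) subrr.
  apply: (@KP_extension _ _ _ _ j (khom_comp (prod_fst E P) d)) kK kE.
    split.
    - move=> x y xy; apply: kI; have := congr1 d xy; rewrite !jE /= => e.
      exact: (congr1 snd e).
    - move=> e; split=> [/= de|[x <-]]; last by have := jE x; rewrite /= => ->.
      have /kkE [x xe] : b (d e).2 = 0 by rewrite -fd /= de khom0.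
      by exists x; apply: dI; rewrite jE /= xe -de; case: (d e).
    - move=> L u cL cu; apply: kC => //.
      rewrite (_ : k \o u = prod_snd E P \o (d \o (j \o u))).
        apply: continuous_comp_all (@khom_continuous _ _ _ _ (prod_snd E P)).
        by apply: (continuous_comp_all cu); exact: khom_continuous.
      by apply/funext => y /=; have := jE (u y); rewrite /= => ->.
  move=> T pT h; have [g gE] := sb T pT (khom_comp p h).
  have [|l lE] := kernel_factor (f := prod_pair h g) kd.
    by move=> x; rewrite fE /= gE subrr.
  by exists l => x; have := lE x; rewrite /= => ->.
have [|r rE] := kernel_factor (f := khom_sub (khom_comp (prod_fst E P) d)
    (khom_comp b' (khom_comp (prod_snd E P) d))) ki.
  by move=> x; rewrite khom_subE khomB /= b'E fd subrr.
have {}rE x : i (r x) = (d x).1 - b' (d x).2 by rewrite rE khom_subE.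
have [|s sE] := kernel_factor (f := khom_comp (prod_inl E P) i) kd.
  by move=> x; rewrite fE /= khom0 (is_kernel_comp0 _ ki) subrr.
have [|w wE] := kernel_factor (f := prod_pair b' (khom_id P)) kd.
  by move=> x; rewrite fE /= b'E subrr.
apply: (@KP_quotient _ _ _ _ w r) => //.
- split.
  + move=> x y xy; have := congr1 d xy; rewrite !wE /= => e.
    exact: (congr1 snd e).
  + move=> e; split=> [re|[x <-]].
      exists (d e).2; apply: dI; rewrite wE /=.
      have := rE e; rewrite re khom0 => /esym /eqP; rewrite subr_eq0 => /eqP <-.
      by case: (d e).
    by apply: iI; rewrite rE wE /= khom0 subrr.
  + move=> L u cL cu.
    rewrite (_ : u = prod_snd E P \o (d \o (w \o u))).
      apply: continuous_comp_all (@khom_continuous _ _ _ _ (prod_snd E P)).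
      by apply: (continuous_comp_all cu); exact: khom_continuous.
    by apply/funext => y /=; have := wE (u y); rewrite /= => ->.
- apply: (@CH_split_retract _ _ _ _ r s) => x.
  by apply: iI; rewrite rE sE /= khom0 subr0.
- apply: KP_projective => // m0; apply: gP => mE; apply: m0.
  by rewrite mE.
Qed.

End KP.
Arguments KP {R G} m A.
Arguments KP_good {R G} m P.

(** * Stepwise and full resolutions *)

Section resolutions.
Context (R : comPzRingType) (G : topGroupType).
Implicit Types A B C X E Z P Q W D F N : kRGModType R G.
Implicit Types m n : option nat.

Lemma iter_natinf_pred k n :
  iter k natinf_pred (natinf_succ n) <> Some 0%N <-> le_natinf k n.
Proof.
have iterE : iter k natinf_pred (natinf_succ n) =
    omap (fun a => (a.+1 - k)%N) n.
  case: n => [a|]; last by elim: k => //= k ->.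
  elim: k => [|k /= ->] //=.
  by rewrite -subnS.
rewrite iterE; case: n {iterE} => [a|] //=; split.
  move=> ak; rewrite leqNgt; apply/negP => ltak; apply: ak.
  by congr Some; apply/eqP; rewrite subn_eq0.
by move=> ka [] /eqP; rewrite subn_eq0 ltnNge ka.
Qed.

Lemma type_KP_KP n A : type_KP n A -> KP (natinf_succ n) A.
Proof.
move=> [P [d [[pP d0 dE s0 se] gP]]].
(* The invariant: being one of the syzygies [syz k] of the given resolution. *)
pose syz k : kRGModType R G := if k is j.+1 then kernel (d j) else A.
exists (fun m X => exists k, m = iter k natinf_pred (natinf_succ n) /\ X = syz k).
split; last by exists 0%N.
move=> m X [k [-> ->]].
suff [p [kp sp]] : exists p : khom (P k) (syz k),
    is_kernel (kernel_incl (d k)) p /\ CH_split p.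
  exists (P k), (kernel (d k)), (kernel_incl (d k)), p; split=> //.
    by split=> // /iter_natinf_pred; exact: gP.
  by exists k.+1.
case: k => [|k] /=; first by exists (d 0%N); split=> //; exact: kernel_is_kernel.
have [e [eE se']] := se k; exists e; split=> //.
have [dI dK dC] := kernel_is_kernel (d k.+1).
split=> // x; rewrite -dK -eE; split=> [->|/=]; first exact: khom0 (kernel_incl (d k)).
by move=> ex; apply: (is_kernel_inj (kernel_is_kernel (d k))); rewrite khom0.
Qed.

Section choice_of_resolution.
Context (good : option nat -> kRGModType R G -> Prop)
  (epi : forall P A, khom P A -> Prop).

Record resolution_state := ResolutionState {
  state_rank : option nat;
  state_module : kRGModType R G;
  state_resolvable : resolvable good epi state_rank state_module
}.

Record resolution_cover (s : resolution_state) := ResolutionCover {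
  cover_next : resolution_state;
  cover_module : kRGModType R G;
  cover_incl : khom (state_module cover_next) cover_module;
  cover_proj : khom cover_module (state_module s)
}.

Lemma resolution_cover_exists (s : resolution_state) :
  exists c : resolution_cover s,
  [/\ good (state_rank s) (cover_module c), epi (cover_proj c),
      is_kernel (cover_incl c) (cover_proj c) &
      state_rank (cover_next c) = natinf_pred (state_rank s)].
Proof.
have [P [X [i [p [? ? ? rX]]]]] := resolvable_unfold (state_resolvable s).
by exists (@ResolutionCover s (ResolutionState rX) P i p).
Qed.

(** Dependent choice turns the stepwise notion into a sequence of short exact
    sequences. *)
Lemma resolvable_sequence m A : resolvable good epi m A ->
  exists (P X : nat -> kRGModType R G) (i : forall k, khom (X k) (P k))
    (p : forall k, khom (P k) (augmented A X k)),
    forall k, [/\ good (iter k natinf_pred m) (P k), epi (p k) &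
      is_kernel (i k) (p k)].
Proof.
move=> rA.
pose c s := projT1 (cid (resolution_cover_exists s)).
have cP s := projT2 (cid (resolution_cover_exists s)).
pose st k := iter k (fun s => cover_next (c s)) (ResolutionState rA).
have rk k : state_rank (st k) = iter k natinf_pred m.
  by elim: k => //= k <-; case: (cP (st k)).
exists (fun k => cover_module (c (st k))), (fun k => state_module (st k.+1)).
exists (fun k => cover_incl (c (st k))).
exists (fun k => match k return khom (cover_module (c (st k)))
      (augmented A (fun j => state_module (st j.+1)) k) with
  | 0%N => cover_proj (c (st 0%N)) | j.+1 => cover_proj (c (st j.+1)) end).
by move=> k; rewrite -rk; case: (cP (st k)); case: k => [|k] ? ? ? _.
Qed.

End choice_of_resolution.

Section splice.
Context (A : kRGModType R G) (P X : nat -> kRGModType R G)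
  (i : forall k, khom (X k) (P k)) (p : forall k, khom (P k) (augmented A X k)).
Context (ki : forall k, is_kernel (i k) (p k)).
Context (sp : forall k a, exists x, p k x = a).

(** The complex obtained from the short exact sequences
    [X k -> P k -> X (k - 1)], where [X (-1)] is [A]. *)
Definition splice k : khom (P k) (augmented A P k) :=
  match k with 0%N => p 0%N | j.+1 => khom_comp (i j) (p j.+1) end.

Lemma splice_eq0 k x : splice k x = 0 <-> p k x = 0.
Proof.
case: k x => // k x /=; split=> [e|->]; last exact: khom0.
by apply: (is_kernel_inj (ki k)); rewrite khom0.
Qed.

Lemma splice_exact k y : splice k y = 0 <-> exists x, splice k.+1 x = y.
Proof.
rewrite splice_eq0; have [_ -> _] := ki k.
split=> -[x xy]; last by exists (p k.+1 x).
by have [z zx] := @sp k.+1 x; exists z; rewrite /= zx.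
Qed.

End splice.

Lemma KP_type_KP n A : KP (natinf_succ n) A -> type_KP n A.
Proof.
move=> /resolvable_sequence [P [X [i [p Pp]]]].
have ki k : is_kernel (i k) (p k) by case: (Pp k).
have sp k : CH_split (p k) by case: (Pp k).
have surj k a : exists x, p k x = a := CH_split_surjective a (sp k).
exists P, (splice i p); split; last first.
  move=> k kn; case: (Pp k) => -[_ gP] _ _; apply: gP.
  exact/iter_natinf_pred.
split.
- by move=> k; case: (Pp k) => -[].
- by move=> a; exact: (surj 0%N).
- move=> k y; exact: splice_exact.
- exact: sp.
- move=> k.
  have kk := kernel_is_kernel (splice i p k).
  have [|e eE] := kernel_factor (f := splice i p k.+1) kk.
    by move=> a; apply/(splice_eq0 ki); exact: is_kernel_comp0 (ki k).
  exists e; split=> // T pT f.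
  have [|g gE] := kernel_factor (f := khom_comp (kernel_incl _) f) (ki k).
    by move=> a; apply/(splice_eq0 ki); exact: kernel_mem.
  have [h hE] := sp k.+1 T pT g.
  exists h => x; apply: (is_kernel_inj kk).
  by rewrite eE /= hE gE.
Qed.

Lemma KP_zero m A : (forall x : A, x = 0) -> KP m A.
Proof.
move=> A0; apply: KP_projective => [|_]; first exact: projective_zero.
exact: compactly_generated_zero.
Qed.

(** The invariant is to be an extension of a module [Z] with a resolution by
    modules of type [KP] by a module [X] of type [KP].  One horseshoe step
    produces a kernel with a filtration whose three pieces are the kernel of the
    cover of [X], the kernel of a cover of the first term [D] of the resolution
    of [Z], and the next syzygy [W] of [Z]; the first two form the new [X], and
    [W] is the new [Z]. *)
Lemma KP_resolvable m A : resolvable KP (@CH_split R G) m A -> KP m A.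
Proof.
move=> rA.
exists (fun m A => exists X Z (i : khom X A) (p : khom A Z),
  [/\ is_kernel i p, CH_split p, KP m X & resolvable KP (@CH_split R G) m Z]).
split; last first.
  exists (kernel (khom_id A)), A, (kernel_incl _), (khom_id A); split=> //.
  - exact: kernel_is_kernel.
  - exact: (@CH_split_retract _ _ _ _ (khom_id A) (khom_id A)).
  - by apply: KP_zero; exact: kernel_id_zero.
move=> {rA} {}m {}A [X [Z [i [p [ki sp]]]]].
move=> /resolvable_unfold [PX [KX [iX [a [[pPX gPX] sa kiX kKX]]]]].
move=> /resolvable_unfold [D [W [w [r [kD sr kw rW]]]]].
have [PD [KD [iD [q [[pPD gPD] sq kiD kKD]]]]] := resolvable_unfold kD.
have [KZ [iZ [t [k' [kiZ st kk']]]]] := kernel_of_composite sq kiD kw.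
have [N [c [n [k [q' [sc kn kk sq']]]]]] :=
  horseshoe ki sp pPD sa kiX (CH_split_comp sr sq) kiZ.
have [N' [n' [t' [k'' [kn' st' kk'']]]]] := kernel_of_composite sq' kk kk'.
exists (prod_module PX PD), N, n, c; split=> //.
  split; first exact: projective_prod.
  by move=> m0; apply: compactly_generated_prod; [exact: gPX|exact: gPD].
exists N', W, n', (khom_comp t q'); split=> //; first exact: CH_split_comp.
exact: KP_extension kk'' st' kKX kKD.
Qed.

End resolutions.

(** * The bar resolution of a permutation module *)

(** [J] indexes the orbits, [U j] is the stabiliser of a base point of the orbit
    [j], and [tau j g] is the chosen representative of the coset [g (U j)]. *)
Section stages.
Context (R : comPzRingType) (G : topGroupType) (hG : tdlc G).
Context (J : choiceType) (U : J -> set G) (tau : J -> G -> G).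
Context (cU : forall j, compact (U j)) (oU : forall j, open_subgroup (U j)).
Context (tauM : forall j g u, U j u -> tau j (g * u)%g = tau j g).
Context (tauU : forall j g, U j ((tau j g)^-1 * g)%g).
Context (tau1 : forall j u, U j u -> tau j u = 1%g).
Implicit Types (A : kRGModType R G) (Y : J -> topologicalType).

Lemma tau_continuous j : continuous (tau j).
Proof.
move=> g V Vg; have [oUj U1 _ _] := oU j.
have : nbhs g [set h | U j (g^-1 * h)%g].
  apply: open_nbhs_nbhs; split; first exact: open_translate.
  by rewrite /= mulVg.
apply: filterS => h /= /(tauM g); rewrite mulgA mulgV mul1g => ->.
exact: nbhs_singleton.
Qed.

Lemma tau_tau j g u : U j u -> tau j (tau j g * u)%g = tau j g.
Proof.
move=> Uu; rewrite tauM // -[LHS](tauM _ (tauU j g)).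
by rewrite mulgA mulgV mul1g.
Qed.

Local Notation F Y := (free_module R G {j & Y j}).
Local Notation eta Y y := (@free_eta R G {j & Y j} y).

(** The [R]-module spanned by the translates by [U j] of the generators in
    [Y j]; the whole module is the sum of the translates of these by the chosen
    coset representatives. *)
Inductive small_span Y (j : J) : F Y -> Prop :=
| small_span0 : small_span j 0
| small_spanD x y : small_span j x -> small_span j y -> small_span j (x + y)
| small_spanZ a x : small_span j x -> small_span j (a *: x)
| small_span_eta u (y : Y j) : U j u ->
    small_span j (gact u (eta Y (existT Y j y))).

Lemma small_span_gact Y j u (x : F Y) :
  U j u -> small_span j x -> small_span j (gact u x).
Proof.
move=> Uu; have [_ _ UM _] := oU j; elim=> [|{}x y _ ux _ uy|a {}x _ ux|v y Uv].
- by rewrite (is_linear_0 (gact_linear u)); exact: small_span0.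
- by rewrite (is_linear_D (gact_linear u)); exact: small_spanD.
- by rewrite (is_linear_Z (gact_linear u)); exact: small_spanZ.
- by rewrite -gactM; apply: small_span_eta; exact: UM.
Qed.

(** A cover [d] of [A] with a continuous linear section [s].  The last two
    conditions say that [s d] preserves the [small_span] of each [j] and commutes
    there with the chosen coset representatives.  They are what [next_stage]
    needs, and what it reproduces. *)
Definition stage A Y (d : khom (F Y) A) (s : A -> F Y) : Prop :=
  [/\ forall j, compact_hausdorff (Y j),
      linear s /\ continuous s, forall a, d (s a) = a,
      forall j (y : Y j) u, U j u ->
        small_span j (s (d (gact u (eta Y (existT Y j y))))) &
      forall j (y : Y j) u g, U j u ->
        s (gact (tau j g) (d (gact u (eta Y (existT Y j y))))) =
        gact (tau j g) (s (d (gact u (eta Y (existT Y j y)))))].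

Lemma family_compactly_generated Y :
  (forall j, compact_hausdorff (Y j)) -> compactly_generated_space {j & Y j}.
Proof.
move=> cY; apply: sum_compactly_generated => j.
exact: compact_hausdorff_compactly_generated.
Qed.

Lemma eta_continuous Y j : (forall j, compact_hausdorff (Y j)) ->
  continuous (fun y => eta Y (existT Y j y)).
Proof.
move=> cY; apply: continuous_comp_all (@existT_continuous _ Y j) _.
by apply: free_eta_continuous; exact: family_compactly_generated.
Qed.

Definition next_family Y (j : J) : topologicalType := (U j * Y j)%type.

(** In terms of generators, the next term is free on the pairs [(u, y)] with [u]
    in [U j] and [y] in [Y j], and [d'] sends [(u, y)] to [x - s (d x)] where
    [x = u y].  The section sends [g y] to [t (t^-1 g, y)] with [t = tau j g],
    and [d'] after it is the projection [x |-> x - s (d x)] onto the kernel of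
    [d], because [s] commutes with [t] on [d (t^-1 g y)]. *)
Lemma next_stage A Y (d : khom (F Y) A) (s : A -> F Y) : stage d s ->
  exists (d' : khom (F (next_family Y)) (kernel d)) s', stage d' s'.
Proof.
move=> [cY [sL sC] ds I1 I2].
have [hausG _ _] := hG.
have cY' j : compact_hausdorff (next_family Y j).
  by apply: compact_hausdorff_prod => //; exact: compact_hausdorff_set_type.
pose b j (z : next_family Y j) : F Y := gact (val z.1) (eta Y (existT Y j z.2)).
pose h0 j z : F Y := b j z - s (d (b j z)).
have dh0 j z : h0 j z \in [set x | d x = 0].
  by apply/mem_set; rewrite /= khomB ds subrr.
pose h (y : {j & next_family Y j}) : kernel d :=
  exist _ (h0 (projT1 y) (projT2 y)) (dh0 (projT1 y) (projT2 y)).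
have bC j : continuous (b j).
  apply: (@continuous_krg_act _ _ _ _ (cY' j) (fun z => val z.1)
     (fun z => eta Y (existT Y j z.2))).
    apply: (@continuous_comp_all _ _ _ (fun z : next_family Y j => z.1)).
      by move=> z; exact: cvg_fst.
    exact: set_val_continuous.
  apply: (@continuous_comp_all _ _ _ (fun z : next_family Y j => z.2)
    (fun y => eta Y (existT Y j y))); last exact: eta_continuous.
  by move=> z; exact: cvg_snd.
have hC : continuous h.
  move=> [j z] V nV; suff : continuous (fun z => h (existT (next_family Y) j z)) by apply.
  apply: set_type_continuous.
  rewrite (_ : _ \o _ = fun z => b j z + (-1) *: s (d (b j z))); last first.
    by apply/funext => t; rewrite scaleN1r.
  apply: continuous_krg_add => //; apply: continuous_krg_scale => //.
  apply: (continuous_comp_all _ sC); apply: (continuous_comp_all (bC j)).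
  exact: khom_continuous.
pose d' := free_lift hC.
have vP j g : ((tau j g)^-1 * g)%g \in U j by apply/mem_set.
pose v j g : U j := exist (fun x => x \in U j) _ (vP j g).
pose Y' := next_family Y.
pose H g (y : {j & Y j}) : F Y' :=
  gact (tau (projT1 y) g)
    (eta Y' (existT Y' (projT1 y) (v (projT1 y) g, projT2 y))).
have [|sigma [sigL sigC sigE]] := free_linear_extension (h := H) hG cY.
  move=> j; apply: continuous_from_cg => [|K u cK cu].
    exact: compact_times_tdlc_compactly_generated.
  have c2 : continuous (fun k => (u k).2) by exact: continuous_comp_snd.
  have ct : continuous (fun k => tau j (u k).2).
    exact: continuous_comp_all c2 (@tau_continuous j).
  apply: (@continuous_krg_act _ _ _ K cK (fun k => tau j (u k).2)
    (fun k => eta Y' (existT Y' j (v j (u k).2, (u k).1)))) => //.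
  apply: (@continuous_comp_all _ _ _ (fun k => (v j (u k).2, (u k).1) : Y' j)
    (fun z => eta Y' (existT Y' j z))); last exact: eta_continuous.
  apply: continuous_pair; last exact: continuous_comp_fst.
  apply: set_type_continuous.
  by apply: mul_continuous => //; exact: inv_continuous.
have sigmaE j (y : Y j) t (w : U j) : tau j (t * val w)%g = t ->
    sigma (gact (t * val w)%g (eta Y (existT Y j y))) =
    gact t (eta Y' (existT Y' j (w, y))).
  move=> tE; rewrite sigE /H /= tE (_ : v j _ = w) //.
  by apply: val_inj; rewrite /= tE mulKg.
have sigma_small j x : small_span j x -> small_span j (sigma x).
  elim=> [|{}x y _ ux _ uy|a {}x _ ux|u y Uu].
  - by rewrite (is_linear_0 sigL); exact: small_span0.
  - by rewrite (is_linear_D sigL); exact: small_spanD.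
  - by rewrite (is_linear_Z sigL); exact: small_spanZ.
  - pose w : U j := exist _ u (mem_set Uu).
    have := sigmaE j y 1%g w; rewrite /= mul1g tau1 // => -> //.
    by apply: small_span_eta; case: (oU j).
have sigma_tau j g x : small_span j x ->
    sigma (gact (tau j g) x) = gact (tau j g) (sigma x).
  elim=> [|{}x y _ ux _ uy|a {}x _ ux|u y Uu].
  - rewrite (is_linear_0 (gact_linear (tau j g))) (is_linear_0 sigL).
    by rewrite (is_linear_0 (gact_linear _)).
  - rewrite (is_linear_D (gact_linear (tau j g))) !(is_linear_D sigL).
    by rewrite (is_linear_D (gact_linear _)) ux uy.
  - rewrite (is_linear_Z (gact_linear (tau j g))) !(is_linear_Z sigL).
    by rewrite (is_linear_Z (gact_linear _)) ux.
  - pose w : U j := exist _ u (mem_set Uu).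
    have := sigmaE j y 1%g w; rewrite /= mul1g tau1 // => -> //.
    rewrite gact1 -gactM.
    by have := sigmaE j y (tau j g) w; rewrite /= tau_tau // => ->.
have d'E j (w : U j) (y : Y j) : val (d' (eta Y' (existT Y' j (w, y)))) =
    gact (val w) (eta Y (existT Y j y)) -
      s (d (gact (val w) (eta Y (existT Y j y)))).
  by rewrite /= free_ev_eta.
have valG g (x : kernel d) : val (gact g x) = gact g (val x) by [].
have d'sigma x : val (d' (sigma x)) = x - s (d x).
  have [t ->] := free_expansion x.
  rewrite -[LHS]/(kernel_incl d _) (is_linear_sum sigL) (khom_sum d').
  rewrite (khom_sum (kernel_incl d)) (khom_sum d) (is_linear_sum sL).
  rewrite -sumrB; apply: eq_bigr => z _.
  rewrite (is_linear_Z sigL) (khomZ d') (khomZ d) (is_linear_Z sL) -scalerBr.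
  rewrite -[LHS]/(z.1.1 *: val (d' _)); congr (_ *: _).
  move: z.1.2 z.2 => g [j y]; rewrite sigE /H (khomG d') valG d'E.
  rewrite (is_linear_B (gact_linear _)) -I2; last exact: tauU.
  by rewrite -!khomG -!gactM mulgA mulgV mul1g.
exists d'. exists (fun x => sigma (val x)); split=> //.
- split=> [a x y|]; first by rewrite -sigL.
  by apply: (continuous_comp_all _ sigC); exact: set_val_continuous.
- by move=> a; apply: val_inj; rewrite d'sigma (kernel_mem a) (is_linear_0 sL) subr0.
- move=> j [w y] u Uu; rewrite khomG valG d'E; apply: sigma_small.
  apply: small_span_gact => //; have Uw := set_mem (valP w).
  rewrite -scaleN1r; apply: small_spanD; first exact: small_span_eta.
  by apply: small_spanZ; exact: I1.
- move=> j [w y] u g Uu; rewrite khomG !valG d'E sigma_tau //.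
  apply: small_span_gact => //; have Uw := set_mem (valP w).
  rewrite -scaleN1r; apply: small_spanD; first exact: small_span_eta.
  by apply: small_spanZ; exact: I1.
Qed.

Lemma stage_KP m A Y (d : khom (F Y) A) s :
  stage d s -> (m <> Some 0%N -> finite_set [set: J]) -> KP m A.
Proof.
move=> ss fJ.
exists (fun m A => (m <> Some 0%N -> finite_set [set: J]) /\
  exists Y (d : khom (F Y) A) s, stage d s); split; last by split=> //; exists Y, d, s.
move=> {ss fJ} {}m {}A [fJ [{}Y [{}d [{}s ss]]]].
have [cY [sL sC] ds _ _] := ss.
have fF := @free_module_free R G _ (family_compactly_generated cY).
exists (F Y), (kernel d), (kernel_incl d), d; split.
- split; first exact: (projective_free cY fF).
  move=> /fJ fJ'; exists {j & Y j}, (F Y), (@free_eta R G _), (khom_id _).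
  split=> //; first exact: compact_hausdorff_sum.
  exact: (@CH_split_retract _ _ _ _ (khom_id _) (khom_id _)).
- exact: CH_split_section sC ds.
- exact: kernel_is_kernel.
- split; first by move=> m0; apply: fJ => mE; apply: m0; rewrite mE.
  have [d' [s' ss']] := next_stage ss.
  by exists (next_family Y), d', s'.
Qed.

Definition point_family (j : J) : topologicalType := discrete_topology unit.

(** The start of the resolution: one generator for each orbit.  The section [s]
    sends a basis element to the chosen translate of the generator of its
    orbit. *)
Lemma permutation_stage A (e : J -> A) (s : A -> F point_family) :
  (forall V : set A, open V) ->
  (forall j u, U j u -> gact u (e j) = e j) ->
  (forall a, exists t : seq (R * G * J), a = \sum_(z <- t) z.1.1 *: gact z.1.2 (e z.2)) ->
  linear s ->
  (forall j g, s (gact g (e j)) =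
     gact (tau j g) (eta point_family (existT point_family j tt))) ->
  exists d, stage d s.
Proof.
move=> dA Ue span sL sE.
pose h (y : {j & point_family j}) : A := e (projT1 y).
have hC : continuous h.
  by move=> [j z] V nV; exact: (@cst_continuous (discrete_topology unit) A (e j) z V nV).
pose d := free_lift hC.
have dE j : d (free_eta R G (existT point_family j tt)) = e j by rewrite /= free_ev_eta.
have tauE j g : gact (tau j g) (e j) = gact g (e j).
  have e1 : g = (tau j g * ((tau j g)^-1 * g))%g by rewrite mulgA mulgV mul1g.
  by rewrite [in RHS]e1 gactM (Ue _ _ (tauU j g)).
exists d; split.
- by move=> j; exact: unit_compact_hausdorff.
- by split=> //; apply/continuousP => V _; exact: dA.
- move=> a; have [t ->] := span a.
  rewrite (is_linear_sum sL) (khom_sum d); apply: eq_bigr => z _.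
  rewrite (is_linear_Z sL) (khomZ d); congr (_ *: _).
  by move: z.1.2 z.2 => g j; rewrite sE khomG dE tauE.
- move=> j [] u Uu; rewrite khomG dE sE tau1 //.
  by apply: small_span_eta; case: (oU j).
- move=> j [] u g Uu; rewrite khomG dE -gactM !sE tau_tau // (tau1 Uu).
  by rewrite gact1.
Qed.

End stages.

(** * Permutation modules have type KP *)

Lemma finite_subtype (T : choiceType) (p : pred T) (L : seq T) :
  (forall x, p x -> x \in L) -> finite_set [set: {x | p x}].
Proof.
move=> pL; apply/finite_seqP; exists (pmap insub L).
apply/seteqP; split=> // x _ /=; rewrite mem_pmap_sub.
exact: pL (valP x).
Qed.

Section basis.
Context (R : comPzRingType) (W : choiceType) (P : lmodType R) (e : W -> P).

Lemma sum_over_uniq (V : nmodType) (F : W -> V) (s t : seq W) :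
  uniq t -> {subset s <= t} ->
  \sum_(w <- s) F w = \sum_(w <- t) F w *+ count_mem w s.
Proof.
move=> ut; elim: s => [_|a s IH st].
  by rewrite big_nil big1 // => w _; rewrite mulr0n.
rewrite big_cons IH => [|w ws]; last by apply: st; rewrite inE ws orbT.
rewrite [RHS](eq_bigr (fun w => F w *+ (a == w) + F w *+ count_mem w s)).
  rewrite big_split /=; congr (_ + _).
  have at_ : a \in t by apply: st; rewrite inE eqxx.
  rewrite (bigD1_seq a) //= eqxx mulr1n big1 ?addr0 // => w wa.
  by rewrite eq_sym (negbTE wa).
by move=> w _; rewrite -mulrnDr.
Qed.

(** Lists of basis elements may have repetitions, so coefficients are first
    collected over a common list without duplicates. *)
Lemma basis_relation (B : lmodType R) (h : W -> B) (s : seq W) (c : W -> R)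
    (s' : seq W) (c' : W -> R) : is_basis e ->
  \sum_(w <- s) c w *: e w = \sum_(w <- s') c' w *: e w ->
  \sum_(w <- s) c w *: h w = \sum_(w <- s') c' w *: h w.
Proof.
move=> [_ be].
pose t := undup (s ++ s').
have ut : uniq t by exact: undup_uniq.
have st : {subset s <= t} by move=> w ws; rewrite mem_undup mem_cat ws.
have s't : {subset s' <= t} by move=> w ws; rewrite mem_undup mem_cat ws orbT.
pose k w := c w *+ count_mem w s - c' w *+ count_mem w s'.
have kE (V : lmodType R) (f : W -> V) : \sum_(w <- t) k w *: f w =
    \sum_(w <- s) c w *: f w - \sum_(w <- s') c' w *: f w.
  rewrite (sum_over_uniq _ ut st) (sum_over_uniq _ ut s't) -sumrB.
  by apply: eq_bigr => w _; rewrite scalerBl -!scalerMnl.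
move=> ss'; have k0 : forall w, w \in t -> k w = 0.
  by apply: be => //; rewrite kE ss' subrr.
apply/eqP; rewrite -subr_eq0 -kE; apply/eqP; rewrite big_seq big1 // => w wt.
by rewrite k0 // scale0r.
Qed.

Lemma basis_extension (B : lmodType R) (h : W -> B) : is_basis e ->
  exists f : P -> B, linear f /\ forall w, f (e w) = h w.
Proof.
move=> be; have [span _] := be.
have /choice [r rE] : forall x, exists r : seq W * (W -> R),
    x = \sum_(w <- r.1) r.2 w *: e w.
  by move=> x; have [s [c xE]] := span x; exists (s, c).
pose f x := \sum_(w <- (r x).1) (r x).2 w *: h w.
have fE s c : f (\sum_(w <- s) c w *: e w) = \sum_(w <- s) c w *: h w.
  by apply: basis_relation => //; rewrite -rE.
exists f; split=> [a x y|w].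
  pose sx := (r x).1; pose sy := (r y).1; pose t := undup (sx ++ sy).
  have ut : uniq t by exact: undup_uniq.
  have st : {subset sx <= t} by move=> w ws; rewrite mem_undup mem_cat ws.
  have s't : {subset sy <= t} by move=> w ws; rewrite mem_undup mem_cat ws orbT.
  pose k w := a * ((r x).2 w *+ count_mem w sx) + (r y).2 w *+ count_mem w sy.
  have kE (V : lmodType R) (g : W -> V) : \sum_(w <- t) k w *: g w =
      a *: (\sum_(w <- sx) (r x).2 w *: g w) + \sum_(w <- sy) (r y).2 w *: g w.
    rewrite (sum_over_uniq _ ut st) (sum_over_uniq _ ut s't) scaler_sumr -big_split.
    by apply: eq_bigr => w _ /=; rewrite scalerDl -scalerA -!scalerMnl.
  by rewrite {1}(rE x) {1}(rE y) -kE fE kE.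
by have := fE [:: w] (fun=> 1); rewrite !big_seq1 !scale1r.
Qed.

End basis.

Section permutation_KP.
Context (R : comPzRingType) (G : topGroupType) (hG : tdlc G).
Implicit Types (A : kRGModType R G) (P : rgModType R G).

Section orbits.
Context (W : choiceType) (act : G -> W -> W) (hact : group_action act).

Definition orbit_rep (w : W) : W :=
  choose (fun w' => `[< exists g, act g w = w' >]) w.

Lemma orbit_repP w : exists g, act g w = orbit_rep w.
Proof.
apply/asboolP.
apply: (chooseP (P := fun w' => `[< exists g, act g w = w' >])).
by apply/asboolP; exists 1%g; case: hact => ->.
Qed.

Lemma orbit_rep_act g w : orbit_rep (act g w) = orbit_rep w.
Proof.
have [act1 actM] := hact.
have eP : (fun w' => `[< exists k, act k (act g w) = w' >]) =1
    (fun w' => `[< exists k, act k w = w' >]).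
  move=> w'; apply/asboolP/asboolP => -[k <-].
    by exists (k * g)%g; rewrite actM.
  by exists (k * g^-1)%g; rewrite -actM -mulgA mulVg mulg1.
rewrite /orbit_rep (eq_choose eP); apply: choose_id; apply/asboolP.
  by exists g.
by exists 1%g.
Qed.

Lemma orbit_rep_rep w : orbit_rep (orbit_rep w) = orbit_rep w.
Proof. by have [g gE] := orbit_repP w; rewrite -[in LHS]gE orbit_rep_act. Qed.

Lemma orbit_rep_inv w : exists g, act g (orbit_rep w) = w.
Proof.
have [act1 actM] := hact; have [g <-] := orbit_repP w.
by exists (g^-1)%g; rewrite -actM mulVg.
Qed.

End orbits.

Lemma open_subgroup_stabiliser (W : choiceType) (act : G -> W -> W) w :
  group_action act -> open [set g | act g w = w] ->
  open_subgroup [set g | act g w = w].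
Proof.
move=> [act1 actM] ow; split=> //= [g h gw hw|g gw]; first by rewrite actM hw.
by rewrite -[in LHS]gw -actM mulVg.
Qed.

(** If the module is finitely generated, the orbits meeting the supports of the
    generators are all the orbits: otherwise, the sum of the coefficients along
    a missed orbit would vanish on the generators and their translates but not
    on a basis element of this orbit.  Over the zero ring this fails, but then
    all modules vanish. *)
Lemma permutation_KP m A : (forall V : set A, open V) ->
  proper_discrete_permutation A -> (m <> Some 0%N -> finitely_generated A) ->
  KP m A.
Proof.
move=> dA [W [act [e [hact prop be eG]]]] fg.
have [[act1 actM] [span _]] := (hact, be).
have [R0|R1] := eqVneq (1 : R) 0.
  apply: KP_zero => x; by rewrite -[x]scale1r R0 scale0r.
pose rep := orbit_rep act.
pose J := {w : W | rep w == w}.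
have repP w : rep (rep w) == rep w by apply/eqP; exact: orbit_rep_rep.
pose jj w : J := exist (fun w => rep w == w) _ (repP w).
pose U (j : J) : set G := [set g | act g (val j) = val j].
(* Representing the trivial coset by [1] is part of the normalisation of
   [tau]. *)
pose t w : G := if w == rep w then 1%g else projT1 (cid (orbit_rep_inv hact w)).
have tE w : act (t w) (rep w) = w.
  rewrite /t; case: eqP => [<-|_]; first exact: act1.
  by case: cid.
pose tau (j : J) g := t (act g (val j)).
have repj (j : J) : rep (val j) = val j by apply/eqP; exact: (valP j).
have repa g (j : J) : rep (act g (val j)) = val j.
  by rewrite /rep (orbit_rep_act hact); exact: repj.
have cU j : compact (U j) by case: (prop (val j)).
have oU j : open_subgroup (U j).
  by apply: open_subgroup_stabiliser => //; case: (prop (val j)).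
have tauM j g u : U j u -> tau j (g * u)%g = tau j g.
  by rewrite /U /tau /= actM => ->.
have tauU j g : U j ((tau j g)^-1 * g)%g.
  have e1 : act (tau j g) (val j) = act g (val j).
    by have := tE (act g (val j)); rewrite repa.
  rewrite -[U j _]/(act _ (val j) = val j) actM -e1 -actM mulVg; exact: act1.
have tau1 j u : U j u -> tau j u = 1%g.
  by rewrite /U /tau /= => ->; rewrite /t repj eqxx.
pose eJ (j : J) : A := e (val j).
pose FP := free_module R G {j : J & point_family j}.
pose etaJ j : FP := free_eta R G (existT (@point_family J) j tt).
have [s [sL sE]] := basis_extension (fun w => gact (t w) (etaJ (jj w))) be.
have [||||d dS] := @permutation_stage R G J U tau oU tauM tauU tau1 A eJ s dA.
- by move=> j u Uu; rewrite /eJ -eG Uu.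
- move=> a; have [r [c ->]] := span a.
  exists [seq (c w, t w, jj w) | w <- r]; rewrite big_map; apply: eq_bigr => w _ /=.
  by rewrite /eJ -eG /= tE.
- exact: sL.
- move=> j g; rewrite /eJ -eG sE; congr (gact _ (etaJ _)).
  by apply: val_inj; rewrite /= repa.
apply: (stage_KP hG cU oU tauM tauU tau1 dS) => m0.
have [S SE] := fg m0.
have /choice [r rE] : forall x, exists r : seq W * (W -> R),
    x = \sum_(w <- r.1) r.2 w *: e w.
  by move=> x; have [l [c xE]] := span x; exists (l, c).
pose L := flatten [seq [seq rep w | w <- (r x).1] | x <- S].
apply: (@finite_subtype _ _ L) => w0 /eqP w0rep.
apply: contrapT => /negP nL.
have [phi [phiL phiE]] := basis_extension (B := R^o) (fun w => (rep w == w0)%:R) be.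
have phi0 g x : x \in S -> phi (gact g x) = 0.
  move=> xS; rewrite [x]rE (is_linear_sum (gact_linear g)) (is_linear_sum phiL).
  rewrite big_seq big1 // => w wr.
  rewrite (is_linear_Z (gact_linear g)) (is_linear_Z phiL) -eG phiE.
  rewrite /rep (orbit_rep_act hact) -/rep; case: eqP => [rw|_]; last by rewrite scaler0.
  exfalso; move/negP: nL; apply; apply/flattenP.
  exists [seq rep w | w <- (r x).1]; first by apply/mapP; exists x.
  by apply/mapP; exists w.
have : phi (e w0) = 0.
  have [l [lS ->]] := SE (e w0).
  rewrite (is_linear_sum phiL) big_seq big1 // => z zl.
  by rewrite (is_linear_Z phiL) phi0 ?scaler0 //; exact: lS.
rewrite phiE w0rep eqxx => /eqP; rewrite mulr1n.
by apply/negP.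
Qed.

End permutation_KP.

(** * Construction of permutation modules *)

Definition finite_support (R : comPzRingType) (W : choiceType) : pred (W -> R^o) :=
  fun f => `[< finite_set [set w | f w <> 0] >].

(** The finitely supported functions on [W]; the action is a parameter because
    the module structure depends on it. *)
Definition permutation_module (R : comPzRingType) (G : topGroupType)
  (W : choiceType) (act : G -> W -> W) (hact : group_action act) : Type :=
  {f : W -> R^o | finite_support f}.

Section permutation_module.
Context (R : comPzRingType) (G : topGroupType) (W : choiceType)
  (act : G -> W -> W) (hact : group_action act).
Local Notation M := (permutation_module R hact).

HB.instance Definition _ := SubChoice.on M.

Lemma finite_support_closed :
  subsemimod_closed (fun f : W -> R^o => finite_support f).
Proof.
split; first split.
- apply/asboolP; rewrite (_ : [set _ | _] = set0); first exact: finite_set0.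
  by apply/seteqP; split=> w //=; apply.
- move=> f g /asboolP ff /asboolP fg; apply/asboolP.
  apply: (@sub_finite_set _ _ ([set w | f w <> 0] `|` [set w | g w <> 0])).
    move=> w /= fgw; have [f0|] := pselect (f w = 0); last by left.
    by right => g0; apply: fgw; rewrite fctE f0 g0 addr0.
  by rewrite finite_setU.
- move=> a f /asboolP ff; apply/asboolP; apply: sub_finite_set ff => w /= afw f0.
  by apply: afw; rewrite -[LHS]/(a *: f w) f0 scaler0.
Qed.

HB.instance Definition _ := GRing.SubChoice_isSubLmodule.Build R (W -> R^o)
  (fun f => finite_support f) M finite_support_closed.

Lemma permutation_gact_subproof (g : G) (f : M) :
  finite_support (fun w => val f (act g^-1%g w)).
Proof.
have [act1 actM] := hact.
have /asboolP ff := valP f; apply/asboolP.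
apply: sub_finite_set (finite_image (act g) ff) => w /= fw.
by exists (act g^-1%g w) => //; rewrite -actM mulgV act1.
Qed.

Definition permutation_gact (g : G) (f : M) : M :=
  exist (fun f => finite_support f) _ (permutation_gact_subproof g f).

Lemma permutation_gact1 f : permutation_gact 1%g f = f.
Proof.
have [act1 actM] := hact.
by apply: val_inj; apply/funext => w /=; rewrite invg1 act1.
Qed.

Lemma permutation_gactM g h f :
  permutation_gact (g * h)%g f = permutation_gact g (permutation_gact h f).
Proof.
have [act1 actM] := hact.
by apply: val_inj; apply/funext => w /=; rewrite invgM actM.
Qed.

Lemma permutation_gact_linear g : linear (permutation_gact g).
Proof. by move=> a f h; apply: val_inj; apply/funext => w. Qed.

HB.instance Definition _ := Lmodule_isRGModule.Build R G M
  permutation_gact1 permutation_gactM permutation_gact_linear.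

Lemma indicator_subproof (w : W) :
  finite_support (fun w' : W => (w' == w)%:R : R^o).
Proof.
apply/asboolP; apply: (@sub_finite_set _ _ [set w]); last exact: finite_set1.
by move=> w' /= ; case: eqP => [->|].
Qed.

Definition indicator (w : W) : M :=
  exist (fun f => finite_support f) _ (indicator_subproof w).

Lemma permutation_module_sumE (s : seq W) (c : W -> R) w :
  val (\sum_(v <- s) c v *: indicator v) w = \sum_(v <- s) c v * (w == v)%:R.
Proof.
elim: s => [|v s IH]; first by rewrite !big_nil.
by rewrite !big_cons -IH.
Qed.

Lemma indicator_basis : is_basis indicator.
Proof.
split.
  move=> f; have /asboolP /finite_seqP [s sE] := valP f.
  exists (undup s), (val f); apply: val_inj; apply/funext => w.
  rewrite permutation_module_sumE.
  have [ws|ws] := boolP (w \in s).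
    rewrite (bigD1_seq w) ?mem_undup ?undup_uniq //= eqxx mulr1 big1 ?addr0 //.
    by move=> v vw; rewrite eq_sym (negbTE vw) mulr0.
  rewrite big_seq big1 => [|v]; last first.
    rewrite mem_undup => vs; case: eqP => [wv|_]; last by rewrite mulr0.
    by rewrite wv vs in ws.
  apply: contrapT => fw; move/negP: ws; apply.
  by have : [set w | sval f w <> 0] w by []; rewrite sE.
move=> s c us s0 w ws; have := congr1 (fun f => val f w) s0.
rewrite permutation_module_sumE (bigD1_seq w) //= eqxx mulr1 big1 ?addr0 //.
by move=> v vw; rewrite eq_sym (negbTE vw) mulr0.
Qed.

Lemma indicator_act g w : indicator (act g w) = gact g (indicator w).
Proof.
have [act1 actM] := hact.
apply: val_inj; apply/funext => v /=; congr (_ %:R); congr nat_of_bool.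
apply/eqP/eqP => [->|<-]; first by rewrite -actM mulVg act1.
by rewrite -actM mulgV act1.
Qed.

Lemma permutation_module_proper :
  (forall w, compact [set g | act g w = w] /\ open [set g | act g w = w]) ->
  proper_discrete_permutation M.
Proof.
move=> hW; exists W, act, indicator; split=> //.
- exact: indicator_basis.
- exact: indicator_act.
Qed.

Lemma permutation_module_extension (N : rgModType R G) (h : W -> N) :
  (forall g w, h (act g w) = gact g (h w)) ->
  exists f : M -> N, rg_morphism f /\ forall w, f (indicator w) = h w.
Proof.
move=> hG; have [f [fL fE]] := basis_extension h indicator_basis.
exists f; split=> //; split=> // g x; have [[s [c ->]] _] := (indicator_basis.1 x, tt).
rewrite (is_linear_sum (gact_linear g)) !(is_linear_sum fL) (is_linear_sum (gact_linear g)).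
apply: eq_bigr => w _; rewrite (is_linear_Z (gact_linear g)) !(is_linear_Z fL).
by rewrite (is_linear_Z (gact_linear g)) -indicator_act !fE hG.
Qed.

End permutation_module.

(** * Discrete modules *)

Section discrete.
Context (R : comPzRingType) (G : topGroupType).
Implicit Types (P : rgModType R G) (A : kRGModType R G).

Definition open_stabilisers P : Prop := forall m : P, open [set g : G | gact g m = m].

(** An element is fixed by the intersection of the stabilisers of finitely many
    points. *)
Lemma permutation_open_stabilisers P :
  proper_discrete_permutation P -> open_stabilisers P.
Proof.
move=> [W [act [e [[act1 actM] prop [span _] eG]]]] m.
have near1 : nbhs (1%g : G) [set g : G | gact g m = m].
  have [s [c ->]] := span m.
  elim: s => [|w s IH].
    by apply: filterE => g; rewrite big_nil /= (is_linear_0 (gact_linear g)).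
  have nw : nbhs (1%g : G) [set g | act g w = w].
    by apply: open_nbhs_nbhs; split; [case: (prop w)|exact: act1].
  apply: filterS (filterI nw IH) => g [/= gw gs].
  rewrite big_cons (is_linear_D (gact_linear g)) gs.
  by rewrite (is_linear_Z (gact_linear g)) -eG gw.
rewrite openE => g /= gm.
have c : continuous (fun h : G => (g^-1 * h)%g).
  by apply: mul_continuous; [exact: cst_continuous|exact: id_continuous_all].
have : nbhs g ((fun h : G => (g^-1 * h)%g) @^-1` [set g : G | gact g m = m]).
  by apply: c; rewrite mulVg.
apply: filterS => h /= hm.
by rewrite -[RHS]gm -[in RHS]hm -gactM mulgA mulgV mul1g.
Qed.

Definition discrete_module P (hP : open_stabilisers P) : Type := P.

HB.instance Definition _ P (hP : open_stabilisers P) :=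
  RGModule.copy (discrete_module hP) P.
HB.instance Definition _ P (hP : open_stabilisers P) :=
  RGModule_isDiscrete.Build R G (discrete_module hP) hP.

Definition discretise P (hP : open_stabilisers P) : kRGModType R G :=
  discrete_topology (discrete_module hP).

Definition discrete_kmodule A : Prop :=
  (forall V : set A, open V) /\ open_stabilisers A.

Lemma discretise_discrete P (hP : open_stabilisers P) :
  discrete_kmodule (discretise hP).
Proof. by split=> // V; exact: discrete_open. Qed.

Lemma discrete_continuous A (Y : topologicalType) (f : A -> Y) :
  discrete_kmodule A -> continuous f.
Proof. by move=> [dA _]; apply/continuousP => V _; exact: dA. Qed.

End discrete.

(** * Covering a discrete module by a permutation module *)

Section cosets.
Context (G : topGroupType) (J : choiceType) (U : J -> set G).
Context (oU : forall j, open_subgroup (U j)) (cU : forall j, compact (U j)).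

Definition left_coset (g : G) (V : set G) : set G := [set x | V (g^-1 * x)%g].

Definition is_coset : pred (J * set G) :=
  fun p => `[< exists g, p.2 = left_coset g (U p.1) >].

(** The disjoint union of the sets of left cosets [G / U j]. *)
Definition coset_space : choiceType := {p : J * set G | is_coset p}.

Lemma left_coset_mul g h V :
  left_coset (g * h)%g V = [set x | left_coset h V (g^-1 * x)%g].
Proof. by apply/seteqP; split=> x; rewrite /left_coset /= invgM mulgA. Qed.

Lemma left_coset_eq j g h :
  left_coset g (U j) = left_coset h (U j) <-> U j (g^-1 * h)%g.
Proof.
have [_ U1 UM UV] := oU j; split=> [e|gh].
  have : left_coset h (U j) h by rewrite /left_coset /= mulVg.
  by rewrite -e.
have hg : U j (h^-1 * g)%g by have := UV _ gh; rewrite invgM invgK.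
apply/seteqP; split=> x; rewrite /left_coset /= => gx.
  by have := UM _ _ hg gx; rewrite -mulgA mulVKg.
by have := UM _ _ gh gx; rewrite -mulgA mulVKg.
Qed.

Lemma coset_act_subproof (g : G) (w : coset_space) :
  is_coset ((val w).1, [set x | (val w).2 (g^-1 * x)%g]).
Proof.
have /asboolP [h hE] := valP w; apply/asboolP; exists (g * h)%g.
by rewrite left_coset_mul /= -hE.
Qed.

Definition coset_act (g : G) (w : coset_space) : coset_space :=
  exist (fun p => is_coset p) _ (coset_act_subproof g w).

Lemma coset_action : group_action coset_act.
Proof.
split=> [w|g h w]; apply: val_inj => /=.
  case: w => -[j C] /= _; congr pair.
  by apply/seteqP; split=> x /=; rewrite invg1 mul1g.
congr pair; apply/seteqP; split=> x /=; by rewrite invgM mulgA.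
Qed.

Lemma base_coset_subproof j : is_coset (j, U j).
Proof.
apply/asboolP; exists 1%g => /=.
by apply/seteqP; split=> x; rewrite /left_coset /= invg1 mul1g.
Qed.

Definition base_coset (j : J) : coset_space :=
  exist (fun p => is_coset p) _ (base_coset_subproof j).

Lemma coset_rep_exists (w : coset_space) :
  exists g, (val w).2 = left_coset g (U (val w).1).
Proof. by have /asboolP := valP w. Qed.

Lemma coset_stabiliser (w : coset_space) g : (val w).2 = left_coset g (U (val w).1) ->
  [set x | coset_act x w = w] = [set x | U (val w).1 (g^-1 * x * g)%g].
Proof.
move=> wE.
have e x : coset_act x w = w <->
    left_coset (x * g)%g (U (val w).1) = left_coset g (U (val w).1).
  rewrite left_coset_mul -wE; split=> [xw|xw].
    by have := congr1 (fun w => (val w).2) xw.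
  by apply: val_inj; rewrite [RHS]surjective_pairing; congr pair; exact: xw.
have [_ _ _ UV] := oU (val w).1.
apply/seteqP; split=> x /=.
  by move/e/esym/left_coset_eq; rewrite mulgA.
move=> Ux; apply/e/esym/left_coset_eq; by rewrite mulgA.
Qed.

Lemma coset_proper w :
  compact [set g | coset_act g w = w] /\ open [set g | coset_act g w = w].
Proof.
have [g wE] := coset_rep_exists w; rewrite (coset_stabiliser wE).
have [oUj _ _ _] := oU (val w).1; split.
  rewrite (_ : [set x | _] = (fun u => g * u * g^-1)%g @` U (val w).1).
    apply: continuous_compact => //; apply: continuous_subspaceT.
    apply: mul_continuous; last exact: cst_continuous.
    by apply: mul_continuous; [exact: cst_continuous|exact: id_continuous_all].
  apply/seteqP; split=> [x /= Ux|_ [u Uu <-] /=].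
    by exists (g^-1 * x * g)%g => //; rewrite !mulgA mulgV mul1g mulgK.
  by rewrite !mulgA mulVg mul1g mulgVK.
apply: (@open_comp _ _ (fun x => g^-1 * x * g)%g) => // x _.
apply: mul_continuous; last exact: cst_continuous.
by apply: mul_continuous; [exact: cst_continuous|exact: id_continuous_all].
Qed.

End cosets.

Section covers.
Context (R : comPzRingType) (G : topGroupType) (hG : tdlc G).
Implicit Types A P F : kRGModType R G.

(** Choose a compact open subgroup [U j] fixing [m j], and send the coset
    [g (U j)] to [g (m j)]. *)
Lemma permutation_cover A (J : choiceType) (m : J -> A) :
  discrete_kmodule A ->
  (forall a, exists t : seq (R * G * J), a = \sum_(z <- t) z.1.1 *: gact z.1.2 (m z.2)) ->
  exists P (p : khom P A),
    [/\ discrete_kmodule P, proper_discrete_permutation P,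
        finite_set [set: J] -> finitely_generated P & forall a, exists x, p x = a].
Proof.
move=> [_ sA] gen.
have /choice [U UP] : forall j, exists U : set G,
    [/\ compact U, open_subgroup U & U `<=` [set g | gact g (m j) = m j]].
  move=> j; apply: van_dantzig => //; apply: open_nbhs_nbhs; split; first exact: sA.
  exact: gact1.
have cU j : compact (U j) by case: (UP j).
have oU j : open_subgroup (U j) by case: (UP j).
have sU j u : U j u -> gact u (m j) = m j by case: (UP j) => _ _; apply.
pose r (w : coset_space U) := projT1 (cid (coset_rep_exists w)).
have rE (w : coset_space U) : (val w).2 = left_coset (r w) (U (val w).1).
  by rewrite /r; case: cid.
pose h (w : coset_space U) := gact (r w) (m (val w).1).
have hE (w : coset_space U) g : (val w).2 = left_coset g (U (val w).1) ->
    h w = gact g (m (val w).1).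
  rewrite rE => /esym /(left_coset_eq oU) /sU gr.
  by rewrite /h -[in RHS]gr -gactM mulVKg.
have hG' g w : h (coset_act g w) = gact g (h w).
  rewrite -gactM; apply: hE; rewrite left_coset_mul -rE //.
have properM := permutation_module_proper R (coset_action U) (coset_proper oU cU).
pose P := discretise (permutation_open_stabilisers properM).
have dP : discrete_kmodule P := discretise_discrete _.
have [f [fM fE]] := permutation_module_extension (coset_action U) hG'.
have fM' : rg_morphism (f : P -> A) := fM.
pose p : khom P A := KHom fM' (discrete_continuous dP).
have baseE w : coset_act (r w) (base_coset U (val w).1) = w.
  apply: val_inj; rewrite /= [RHS]surjective_pairing; congr pair.
  by rewrite [RHS]rE.
exists P, p; split=> //.
- move=> /finite_seqP [L LE].
  exists [seq (indicator R (coset_action U) (base_coset U j) : P) | j <- L] => x.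
  have [s [c ->]] := (indicator_basis R (coset_action U)).1 x.
  exists [seq (c w, r w,
    (indicator R (coset_action U) (base_coset U (val w).1) : P)) | w <- s].
  split=> [a /mapP [w ws ->] /=|].
    apply/mapP; exists (val w).1 => //.
    by have : [set: J] (val w).1 by []; rewrite LE.
  rewrite big_map; apply: eq_bigr => w _ /=.
  by rewrite -[gact _ _](indicator_act R (coset_action U)) baseE.
- move=> a; have [t ->] := gen a.
  exists (\sum_(z <- t) z.1.1 *: gact z.1.2
    (indicator R (coset_action U) (base_coset U z.2) : P)).
  rewrite khom_sum; apply: eq_bigr => z _; rewrite khomZ khomG; congr (_ *: gact _ _).
  rewrite -[LHS]/(f _) fE (hE _ 1%g) ?gact1 //.
  by apply/seteqP; split=> x; rewrite /left_coset /= invg1 mul1g.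
Qed.

(** By uniqueness, the identity of [F] factors through the free module
    constructed above, which is spanned by construction. *)
Lemma free_on_expansion (Y : topologicalType) F (eta : Y -> F) x :
  compactly_generated_space Y -> free_on eta ->
  exists s : seq (R * G * Y), x = \sum_(a <- s) a.1.1 *: gact a.1.2 (eta a.2).
Proof.
move=> gY fF; have [ceta uF] := fF.
have [phi [phiE _]] := uF (free_module R G Y) (@free_eta R G Y) (free_eta_continuous gY).
pose psi := free_lift ceta.
have psiphi : khom_comp psi phi =1 khom_id F.
  by apply: (free_khom_eq fF) => y; rewrite /= phiE /= free_ev_eta.
have [s sE] := free_expansion (phi x).
have e : psi (phi x) = x := psiphi x.
exists s; rewrite -[LHS]e sE khom_sum; apply: eq_bigr => a _.
by rewrite khomZ khomG /= free_ev_eta.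
Qed.

(** If the image were infinite, the sets whose complement has finite image would
    form a proper filter without cluster point, as the fibres of [h] are open. *)
Lemma compact_image_finite (K : topologicalType) A (h : K -> A) :
  discrete_kmodule A -> compact [set: K] -> continuous h -> finite_set (range h).
Proof.
move=> [dA _] cK ch; apply: contrapT => infh.
pose F : set_system K := [set S | finite_set (h @` ~` S)].
have FF : ProperFilter F.
  split; first by rewrite /F /= setC0.
  split=> [|S T|S T ST]; rewrite /F /=.
  - by rewrite setCT image_set0; exact: finite_set0.
  - by move=> fS fT; rewrite setCI image_setU finite_setU.
  - by apply: sub_finite_set; apply: image_subset; exact: subsetC.
have [|x [_ clx]] := cK F FF; first by rewrite /F /= setCT image_set0; exact: finite_set0.
have Vx : nbhs x (h @^-1` [set h x]).
  by apply: ch; apply: open_nbhs_nbhs; split=> //; exact: dA.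
have [|y [ny hy]] := clx (~` (h @^-1` [set h x])) _ _ Vx; last exact: ny.
rewrite /F /= setCK; apply: (@sub_finite_set _ _ [set h x]); last exact: finite_set1.
by move=> _ [z /= hz <-].
Qed.

Lemma compactly_generated_finite A P (p : khom P A) :
  discrete_kmodule A -> compactly_generated P -> CH_split p ->
  exists B : set A, finite_set B /\ forall a, exists t : seq (R * G * B),
    a = \sum_(z <- t) z.1.1 *: gact z.1.2 (val z.2).
Proof.
move=> dA [K [F [eta [f [cK fF sf]]]]] sp.
pose h y := p (f (eta y)).
have ch : continuous h.
  apply: (@continuous_comp_all _ _ _ (fun y => f (eta y))).
    by apply: (continuous_comp_all fF.1); exact: khom_continuous.
  exact: khom_continuous.
exists (range h); split; first by apply: compact_image_finite => //; case: cK.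
move=> a; have [x xa] := CH_split_surjective a (CH_split_comp sp sf).
have [s sE] := free_on_expansion x (compact_hausdorff_compactly_generated cK) fF.
have hB y : h y \in range h by apply/mem_set; exists y.
pose b y : range h := exist (fun a => a \in range h) _ (hB y).
exists [seq (z.1, b z.2) | z <- s]; rewrite -xa sE khom_sum big_map.
by apply: eq_bigr => z _; rewrite khomZ khomG.
Qed.

End covers.

(** * Comparison of the two types *)

Section comparison.
Context (R : comPzRingType) (G : topGroupType) (hG : tdlc G).
Implicit Types (A B P X : kRGModType R G) (m n : option nat).

Definition FP_good m P : Prop :=
  [/\ discrete_kmodule P, proper_discrete_permutation P &
      m <> Some 0%N -> finitely_generated P].

Definition surjective_khom P A (p : khom P A) : Prop := forall a, exists x, p x = a.

Definition FP : option nat -> kRGModType R G -> Prop :=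
  resolvable FP_good surjective_khom.

Lemma kernel_discrete X P A (i : khom X P) (p : khom P A) :
  is_kernel i p -> discrete_kmodule P -> discrete_kmodule X.
Proof.
move=> ki [dP sP]; split=> [V|x].
  rewrite (_ : V = i @^-1` (i @` V)).
    by apply: open_comp => [y _|]; [exact: khom_continuous|exact: dP].
  apply/seteqP; split=> [v Vv|v [w Vw /(is_kernel_inj ki) <- //]]; by exists v.
rewrite (_ : [set g | _] = [set g | gact g (i x) = i x]); first exact: sP.
apply/seteqP; split=> g /= e; first by rewrite -khomG e.
by apply: (is_kernel_inj ki); rewrite khomG.
Qed.

Lemma discrete_CH_split P A (p : khom P A) :
  discrete_kmodule A -> surjective_khom p -> CH_split p.
Proof.
move=> dA /choice [s sE].
exact: CH_split_section (discrete_continuous (f := s) dA) sE.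
Qed.

Lemma FP_KP m A : discrete_kmodule A -> FP m A -> KP m A.
Proof.
move=> dA fA; apply: KP_resolvable.
exists (fun m A => discrete_kmodule A /\ FP m A); split=> // {dA fA} {}m {}A [dA].
move=> /resolvable_unfold [P [X [i [p [[dP pP gP] sp ki fX]]]]].
exists P, X, i, p; split=> //.
- by apply: permutation_KP => //; case: dP.
- exact: discrete_CH_split.
- by split=> //; exact: kernel_discrete ki dP.
Qed.

Lemma KP_FP m A : discrete_kmodule A -> KP m A -> FP m A.
Proof.
move=> dA kA.
exists (fun m A => discrete_kmodule A /\ KP m A); split=> // {dA kA} {}m {}A [dA kA].
have [P [p [dP pP gP sp]]] : exists P (p : khom P A),
    [/\ discrete_kmodule P, proper_discrete_permutation P,
        m <> Some 0%N -> finitely_generated P & surjective_khom p].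
  (* In rank zero nothing has to be finite, and all elements serve as
     generators. *)
  have [m0|m0] := pselect (m = Some 0%N).
    have [|P [p [dP pP _ sp]]] := permutation_cover hG (m := @id A) dA.
      by move=> a; exists [:: (1, 1%g, a)]; rewrite big_seq1 /= scale1r gact1.
    by exists P, p; split.
  have [P0 [X0 [i0 [p0 [[_ g0] s0 _ _]]]]] := resolvable_unfold kA.
  have [B [fB gB]] := compactly_generated_finite dA (g0 m0) s0.
  have [P [p [dP pP gP sp]]] := permutation_cover hG (m := fun b : B => val b) dA gB.
  exists P, p; split=> // _; apply: gP.
  have /finite_seqP [L LE] := fB.
  apply: (@finite_subtype _ _ L) => x xB.
  by have := set_mem xB; rewrite LE.
have [X [i ki]] := exists_kernel p.
exists P, X, i, p; split=> //; split; first exact: kernel_discrete ki dP.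
apply: (KP_kernel ki (discrete_CH_split dA sp)) kA.
apply: permutation_KP => //; first by case: dP.
by move=> m0; apply: gP => mE; apply: m0; rewrite mE.
Qed.

Lemma FP_type_FP n A : FP (natinf_succ n) A -> type_FP n A.
Proof.
move=> /resolvable_sequence [P [X [i [p Pp]]]].
have ki k : is_kernel (i k) (p k) by case: (Pp k).
have surj k a : exists x, p k x = a by case: (Pp k) => _ + _; apply.
exists (fun k => P k).
exists (fun k => match k return P k ->
    augmented (A : rgModType R G) (fun j => P j : rgModType R G) k with
  | 0%N => splice i p 0%N | j.+1 => splice i p j.+1 end).
split.
- by case=> [|k]; exact: khom_morphism.
- exact: (surj 0%N).
- case=> [|k] y; first exact: (splice_exact ki surj (k := 0%N)).
  exact: (splice_exact ki surj (k := k.+1)).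
- by move=> k; case: (Pp k) => -[].
- by move=> k kn; case: (Pp k) => -[_ _ gP] _ _; apply: gP; exact/iter_natinf_pred.
Qed.

Lemma type_FP_FP n (M : discreteRGModType R G) :
  type_FP n M -> FP (natinf_succ n) (discrete_topology M).
Proof.
move=> [P [d [dM d0 dE pP gP]]].
have oP k : open_stabilisers (P k) := permutation_open_stabilisers (pP k).
pose D k := discretise (oP k).
have dD k : discrete_kmodule (D k) := discretise_discrete _.
pose A : kRGModType R G := discrete_topology M.
have dC0 : continuous (d 0%N : D 0%N -> A) := discrete_continuous (dD 0%N).
have dC k : continuous (d k.+1 : D k.+1 -> D k) := discrete_continuous (dD k.+1).
pose dk k : khom (D k) (augmented A D k) :=
  match k return khom (D k) (augmented A D k) with
  | 0%N => @KHom R G (D 0%N) A _ (dM 0%N) dC0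
  | j.+1 => @KHom R G (D j.+1) (D j) _ (dM j.+1) (dC j)
  end.
have dkE k y : dk k y = 0 <-> exists x, dk k.+1 x = y.
  by case: k y => [|k] y; [exact: (dE 0%N y)|exact: (dE k.+1 y)].
pose syz k : kRGModType R G := if k is j.+1 then kernel (dk j) else A.
exists (fun m X => exists k, m = iter k natinf_pred (natinf_succ n) /\ X = syz k).
split; last by exists 0%N.
move=> m X [k [-> ->]].
suff [p [kp sp]] : exists p : khom (D k) (syz k),
    is_kernel (kernel_incl (dk k)) p /\ surjective_khom p.
  exists (D k), (kernel (dk k)), (kernel_incl (dk k)), p; split=> //.
    split=> //; first exact: pP.
    by move=> /iter_natinf_pred; exact: gP.
  by exists k.+1.
case: k => [|k] /=; first by exists (dk 0%N); split; [exact: kernel_is_kernel|exact: d0].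
have kk := kernel_is_kernel (dk k).
have [|e eE] := kernel_factor (f := dk k.+1) kk.
  by move=> a; apply/dkE; exists a.
exists e; split.
  have [dI dK dC'] := kernel_is_kernel (dk k.+1).
  split=> // x; rewrite -dK -eE; split=> [->|ex]; first exact: khom0.
  by apply: (is_kernel_inj kk); rewrite khom0.
move=> x; have /dkE [y yx] : dk k (kernel_incl (dk k) x) = 0 by exact: kernel_mem.
by exists y; apply: (is_kernel_inj kk); rewrite eE.
Qed.

End comparison.

Theorem theorem3p10 (G : topGroupType) (hG : tdlc G) (R : comPzRingType)
    (n : option nat) (M : discreteRGModType R G) :
  type_FP n M <-> type_KP n (discrete_topology M).
Proof.
have dM : discrete_kmodule (discrete_topology M : kRGModType R G).
  by split=> [V|]; [exact: discrete_open|exact: (@open_stabiliser R G M)].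
split=> [fM|kM].
  by apply: KP_type_KP; apply: FP_KP => //; exact: type_FP_FP.
have := FP_type_FP (KP_FP hG dM (type_KP_KP kM)).
exact.
Qed.
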